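(* Let $B$ be an infinite Blaschke product with uniformly separated zeros $\{a_j\}_{j=1}^\infty$. For $n\in\mathbb{N}$ let $B_n(z)=\prod_{j=1}^n\frac{z-a_j}{1-\bar a_jz}$, $C_n=C_{B_n}$, and let $P_n$ be the orthogonal projection of $K^2_B$ onto $K^2_{B_n}$. Let $A$ be a bounded linear operator on $K^2_B$. The following are equivalent: (1) $A\in\mathcal{T}(B)$; (2) for every nonconstant Blaschke product $B_\sigma$ dividing $B$, the operator $A_\sigma=P_{B_\sigma}A|_{K^2_{B_\sigma}}$ is $C_{B_\sigma}$--symmetric; (3) for every $n\in\mathbb{N}$, the operator $A_n=P_nA|_{K^2_{B_n}}$ is $C_n$--symmetric.
   Context: $B(z)=e^{i\gamma}\prod_{j=1}^\infty\frac{\bar a_j}{|a_j|}\frac{a_j-z}{1-\bar a_jz}$, $\gamma\in\mathbb{R}$ (with $\bar a_j/|a_j|$ read as $-1$ if $a_j=0$), where the zeros are uniformly separated: there is $\delta>0$ with $\inf_n\prod_{j\ne n}\left|\frac{a_j-a_n}{1-\bar a_ja_n}\right|\ge\delta$ (in particular the $a_j$ are distinct). For inner $\theta$: $K^2_\theta=H^2\ominus\theta H^2$, $P_\theta$ the orthogonal projection onto it, $C_\theta f(z)=\theta(z)\overline{zf(z)}$ on $|z|=1$; $T$ is $C_\theta$--symmetric if $C_\theta TC_\theta=T^*$. An inner $\alpha$ divides $\theta$ if $\bar\alpha\theta$ is inner. For $\varphi\in L^2$, $A^\theta_\varphi f=P_\theta(\varphi f)$ on $\{f\in K^2_\theta:\varphi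 f\in L^2\}$, and $\mathcal{T}(\theta)$ is the set of bounded such operators (truncated Toeplitz operators). *)

(* Defs.v *)
(* Model: L^2(T) is identified (Plancherel) with
   two-sided square-summable Fourier coefficient sequences  Z -> C. *)
From Stdlib Require Import Reals ZArith Lra.
From Coquelicot Require Import Coquelicot.
Open Scope C_scope.

Definition posp (a : Z -> C) (n : nat) : C := a (Z.of_nat n).
Definition negp (a : Z -> C) (n : nat) : C := a (- Z.of_nat (S n))%Z.

Definition L2 (f : Z -> C) : Prop :=
  ex_series (fun n => (Cmod (posp f n) ^ 2)%R) /\
  ex_series (fun n => (Cmod (negp f n) ^ 2)%R).

(* value of a two-sided sum (meaningful when it converges) *)
Definition sumZ (a : Z -> C) : C :=
  ((Series (fun n => Re (posp a n)) + Series (fun n => Re (negp a n)))%R,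
   (Series (fun n => Im (posp a n)) + Series (fun n => Im (negp a n)))%R).

Definition norm2 (f : Z -> C) : R :=
  (Series (fun n => Cmod (posp f n) ^ 2) + Series (fun n => Cmod (negp f n) ^ 2))%R.

Definition ip (f g : Z -> C) : C := sumZ (fun n => f n * Cconj (g n)).

(* Fourier coefficients of the product of two L^2 functions *)
Definition mulF (phi f : Z -> C) : Z -> C :=
  fun n => sumZ (fun k => phi k * f (n - k)%Z).

Definition H2 (f : Z -> C) : Prop := L2 f /\ forall n, (n < 0)%Z -> f n = 0.

Definition Kmodel (theta : Z -> C) (f : Z -> C) : Prop :=
  H2 f /\ forall h, H2 h -> ip f (mulF theta h) = 0.

Definition is_proj (K : (Z -> C) -> Prop) (g p : Z -> C) : Prop :=
  K p /\ forall k, K k -> ip (fun n => g n - p n) k = 0.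

(* conjugation C_theta f = theta * conj(z f) on the circle:
   the n-th Fourier coefficient of conj(z f) is conj(f_(-n-1)) *)
Definition Cop (theta : Z -> C) (f : Z -> C) : Z -> C :=
  mulF theta (fun n => Cconj (f (- n - 1)%Z)).

Definition bounded_op (K : (Z -> C) -> Prop) (A : (Z -> C) -> Z -> C) : Prop :=
  (forall f, K f -> K (A f)) /\
  (forall f g (c : C), K f -> K g ->
      A (fun n => c * f n + g n) = (fun n => c * A f n + A g n)) /\
  (exists M : R, forall f, K f -> (norm2 (A f) <= M * norm2 f)%R).

Definition in_TTO (theta : Z -> C) (A : (Z -> C) -> Z -> C) : Prop :=
  exists phi, L2 phi /\
    forall f, Kmodel theta f -> L2 (mulF phi f) ->
      is_proj (Kmodel theta) (mulF phi f) (A f).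

(* the compression P_theta A |_{K_theta} is C_theta-symmetric:
   C T C = T^*, i.e. <C T C f, g> = <f, T g> for all f, g in K_theta *)
Definition compression_Csym (theta : Z -> C) (A : (Z -> C) -> Z -> C) : Prop :=
  forall f g p q, Kmodel theta f -> Kmodel theta g ->
    is_proj (Kmodel theta) (A (Cop theta f)) p ->
    is_proj (Kmodel theta) (A g) q ->
    ip (Cop theta p) g = ip f q.

Definition taylor_of (F : nat -> C -> C) (c : nat -> C) : Prop :=
  forall z : C, (Cmod z < 1)%R ->
    exists w : C, is_series (fun k => c k * pow_n z k) w /\
                  filterlim (fun N => F N z) eventually (locally w).

Definition extZ (c : nat -> C) : Z -> C :=
  fun n => match n with
           | Z0 => c O
           | Zpos p => c (Pos.to_nat p)
           | Zneg _ => 0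
           end.

Definition bconst (a : C) : C :=
  if Req_EM_T (Cmod a) 0 then RtoC (-1) else Cconj a / RtoC (Cmod a).

Definition bfactor (a z : C) : C := bconst a * ((a - z) / (1 - Cconj a * z)).

Fixpoint bprod0 (a : nat -> C) (sigma : nat -> bool) (N : nat) (z : C) : C :=
  match N with
  | O => 1
  | S m => bprod0 a sigma m z * (if sigma m then bfactor (a m) z else 1)
  end.

Definition bprod (a : nat -> C) (sigma : nat -> bool) (gamma : R) (N : nat) (z : C) : C :=
  (cos gamma, sin gamma) * bprod0 a sigma N z.

(* B_n(z) = prod_{j < n} (z - a_j)/(1 - bar a_j z)  (indices shifted to start at 0) *)
Fixpoint Bn (a : nat -> C) (n : nat) (z : C) : C :=
  match n with
  | O => 1
  | S m => Bn a m z * ((z - a m) / (1 - Cconj (a m) * z))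
  end.

Fixpoint sep_partial (a : nat -> C) (n : nat) (N : nat) : R :=
  match N with
  | O => 1%R
  | S m => (sep_partial a n m *
            (if Nat.eq_dec m n then 1
             else Cmod ((a m - a n) / (1 - Cconj (a m) * a n))))%R
  end.

(* Main.v *)
(* Every L^2 symbol phi satisfies <C k_j, phi k_i> = <C k_i, phi k_j>, where k_j is the reproducing
   kernel at a_j: both sides are the same integral on the circle.  As the kernels at the zeros span
   the model space, the compressions of an operator in T(B) are C-symmetric.

   Conversely, put psi := (1 - conj(a_0) z) and let phi be
   psi A k_0 + conj (psi A^* k_0) - (1 - |a_0|^2) <A k_0, k_0>.  With E := A - A_phi, the numbers
   <E k_j, k_i> vanish whenever i = 0 or j = 0.  Suppose that they vanish for i, j < n and project
   E k_i to K_(B_(n+1)), calling the result y_i.  For i < n, y_i vanishes at a_0, ..., a_(n-1),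
   hence is a multiple of C k_n, and C y_i a multiple of k_n; symmetry against y_0 = 0 evaluates
   C y_i at a_0 to zero, so y_i = 0.  Then C y_n vanishes at a_0, ..., a_(n-1), so y_n is a multiple
   of k_n which vanishes at a_0, and y_n = 0.  Thus A and A_phi agree on all kernels,
   hence on the domain of A_phi, because f -> <phi f, k_i> is bounded.
   Uniform separation enters only through the distinctness of the zeros. *)
Require Import Defs.
From Stdlib Require Import Reals ZArith.
From Coquelicot Require Import Coquelicot.
From Stdlib Require Import Lra Lia FunctionalExtensionality.
Open Scope C_scope.

(** * Two-sided real series *)

(** All arguments run on Fourier coefficients: |theta| = 1 becomes orthonormality of the shifts of
    [theta], and identities on the circle are checked on the basis [e m] and extended by
    boundedness. The obstacle is that [mulF] of two square-summable sequences need not be square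
    summable. Products can be regrouped for bounded multipliers, whereas [phi] is only in L^2.
    Kernels are bounded, so [phi] is tested on kernels, and [mulF_adj_ker] moves it off an arbitrary
    [f]. The shape of [phi] is forced: (1 - b conj(d)) <phi k_d, k_b> is a function of b plus a
    function of d minus a constant, so prescribing it for d = a_0 and for b = a_0 fixes both
    functions up to constants. The number (1 - |a_0|^2) <A k_0, k_0> belongs to both prescriptions
    and would otherwise be counted twice. Infinite products are limits in norm. Divisibility of
    functions vanishing at the zeros is proved for partial products and passes to the limit, which
    replaces the factorisation theory of H^2. *)

Definition SR (a : Z -> R) : Prop :=
  ex_series (fun n => Rabs (a (Z.of_nat n))) /\
  ex_series (fun n => Rabs (a (- Z.of_nat (S n))%Z)).

Definition sumR (a : Z -> R) : R :=
  (Series (fun n => a (Z.of_nat n)) + Series (fun n => a (- Z.of_nat (S n))%Z))%R.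

Lemma SR_le (a b : Z -> R) : (forall n, (Rabs (a n) <= b n)%R) -> SR b -> SR a.
Proof.
  intros H [H1 H2].
  assert (Hb : forall n, Rabs (b n) = b n).
  { intro n. apply Rabs_pos_eq. eapply Rle_trans; [apply Rabs_pos | apply H]. }
  split.
  - apply (ex_series_le (K := R_AbsRing) (V := R_CompleteNormedModule)) with (2 := H1).
    intro n. simpl. unfold norm; simpl. unfold abs; simpl. rewrite Rabs_Rabsolu, Hb. apply H.
  - apply (ex_series_le (K := R_AbsRing) (V := R_CompleteNormedModule)) with (2 := H2).
    intro n. unfold norm; simpl. unfold abs; simpl. rewrite Rabs_Rabsolu, Hb. apply H.
Qed.

Lemma SR_plus (a b : Z -> R) : SR a -> SR b -> SR (fun n => (a n + b n)%R).
Proof.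
  intros [H1 H2] [K1 K2].
  apply SR_le with (fun n => (Rabs (a n) + Rabs (b n))%R).
  - intro n. apply Rabs_triang.
  - split; eapply ex_series_ext;
      [| exact (ex_series_plus _ _ H1 K1) | | exact (ex_series_plus _ _ H2 K2)];
      intro n; unfold plus; simpl; symmetry; apply Rabs_pos_eq;
      apply Rplus_le_le_0_compat; apply Rabs_pos.
Qed.

Lemma SR_scal (c : R) (a : Z -> R) : SR a -> SR (fun n => (c * a n)%R).
Proof.
  intros [H1 H2].
  split; eapply ex_series_ext;
    [| exact (ex_series_scal_l (Rabs c) _ H1) | | exact (ex_series_scal_l (Rabs c) _ H2)];
    intro n; unfold scal; simpl; unfold mult; simpl; symmetry; apply Rabs_mult.
Qed.

(** Index 0 lies in the non-negative half, so reflection swaps the two halves only up to one term;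
    this is the source of the index increments here and in [sumR_refl]. *)
Lemma SR_refl (a : Z -> R) : SR a -> SR (fun n => a (- n)%Z).
Proof.
  intros [H1 H2]. split.
  - apply ex_series_incr_1. exact H2.
  - apply ex_series_incr_1 in H1. eapply ex_series_ext; [| exact H1].
    intro n. cbv beta. do 2 f_equal; lia.
Qed.

Lemma SR_sh1 (a : Z -> R) : SR a -> SR (fun n => a (n - 1)%Z).
Proof.
  intros [H1 H2]. split.
  - apply ex_series_incr_1. eapply ex_series_ext; [| exact H1].
    intro n. cbv beta. do 2 f_equal; lia.
  - apply ex_series_incr_1 in H2. eapply ex_series_ext; [| exact H2].
    intro n. cbv beta. do 2 f_equal; lia.
Qed.

Lemma SR_sh_nat (k : nat) (a : Z -> R) : SR a -> SR (fun n => a (n - Z.of_nat k)%Z).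
Proof.
  induction k as [|k IH]; intro H.
  - replace (fun n => a (n - Z.of_nat 0)%Z) with a; [exact H |].
    apply functional_extensionality; intro n; f_equal; lia.
  - replace (fun n => a (n - Z.of_nat (S k))%Z)
      with (fun n => (fun p => a (p - Z.of_nat k)%Z) (n - 1)%Z).
    + apply (SR_sh1 _ (IH H)).
    + apply functional_extensionality; intro n; cbv beta; f_equal; lia.
Qed.

Lemma SR_sh (m : Z) (a : Z -> R) : SR a -> SR (fun n => a (n - m)%Z).
Proof.
  intro H. destruct (Z_le_gt_dec 0 m) as [Hm|Hm].
  - replace m with (Z.of_nat (Z.to_nat m)) by lia. apply SR_sh_nat, H.
  (* A shift in the negative direction is a positive shift conjugated by the reflection. *)
  - pose proof (SR_refl _ (SR_sh_nat (Z.to_nat (- m)) _ (SR_refl _ H))) as K.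
    cbv beta in K. replace (fun n => a (n - m)%Z)
      with (fun n => a (- (- n - Z.of_nat (Z.to_nat (- m))))%Z); [exact K |].
    apply functional_extensionality; intro n; f_equal; lia.
Qed.

Lemma sumR_plus (a b : Z -> R) :
  SR a -> SR b -> sumR (fun n => (a n + b n)%R) = (sumR a + sumR b)%R.
Proof.
  intros [H1 H2] [K1 K2]. unfold sumR.
  rewrite Series_plus by (apply ex_series_Rabs; assumption).
  rewrite Series_plus by (apply ex_series_Rabs; assumption). ring.
Qed.

Lemma sumR_scal (c : R) (a : Z -> R) : sumR (fun n => (c * a n)%R) = (c * sumR a)%R.
Proof. unfold sumR. rewrite !Series_scal_l. ring. Qed.

Lemma sumR_refl (a : Z -> R) : SR a -> sumR (fun n => a (- n)%Z) = sumR a.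
Proof.
  intros Ha. pose proof (SR_refl _ Ha) as [K1 K2]. destruct Ha as [H1 H2]. unfold sumR.
  rewrite (Series_incr_1 (fun n => a (- Z.of_nat n)%Z)) by (apply ex_series_Rabs, K1).
  rewrite (Series_incr_1 (fun n => a (Z.of_nat n))) by (apply ex_series_Rabs, H1).
  rewrite (Series_ext (fun n => a (- - Z.of_nat (S n))%Z) (fun n => a (Z.of_nat (S n)))).
  - simpl (- Z.of_nat 0)%Z. simpl (Z.of_nat 0). ring.
  - intro n. f_equal; lia.
Qed.

Lemma sumR_sh1 (a : Z -> R) : SR a -> sumR (fun n => a (n - 1)%Z) = sumR a.
Proof.
  intros Ha. pose proof (SR_sh1 _ Ha) as [K1 K2]. destruct Ha as [H1 H2]. unfold sumR.
  rewrite (Series_incr_1 (fun n => a (Z.of_nat n - 1)%Z)) by (apply ex_series_Rabs, K1).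
  rewrite (Series_incr_1 (fun n => a (- Z.of_nat (S n))%Z)) by (apply ex_series_Rabs, H2).
  rewrite (Series_ext (fun n => a (Z.of_nat (S n) - 1)%Z) (fun n => a (Z.of_nat n))).
  2:{ intro n. f_equal; lia. }
  rewrite (Series_ext (fun n => a (- Z.of_nat (S n) - 1)%Z) (fun n => a (- Z.of_nat (S (S n)))%Z)).
  2:{ intro n. f_equal; lia. }
  simpl (Z.of_nat 0 - 1)%Z. simpl (- Z.of_nat 1)%Z. ring.
Qed.

Lemma sumR_sh_nat (k : nat) (a : Z -> R) :
  SR a -> sumR (fun n => a (n - Z.of_nat k)%Z) = sumR a.
Proof.
  intro H. induction k as [|k IH].
  - f_equal. apply functional_extensionality; intro n; f_equal; lia.
  - rewrite <- IH, <- (sumR_sh1 (fun p => a (p - Z.of_nat k)%Z)) by (apply SR_sh, H).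
    f_equal. apply functional_extensionality; intro n; f_equal; lia.
Qed.

Lemma sumR_sh (m : Z) (a : Z -> R) : SR a -> sumR (fun n => a (n - m)%Z) = sumR a.
Proof.
  intro H. destruct (Z_le_gt_dec 0 m) as [Hm|Hm].
  - replace m with (Z.of_nat (Z.to_nat m)) by lia. apply sumR_sh_nat, H.
  - rewrite <- (sumR_sh_nat (Z.to_nat (- m)) (fun n => a (n - m)%Z)) by (apply SR_sh, H).
    f_equal. apply functional_extensionality; intro n; f_equal; lia.
Qed.

(** Pairing index n with -n-1 merges the two halves into one sequence of sums over the window from
    -N-1 to N, to which monotone convergence applies. *)
Definition psum (a : Z -> R) (N : nat) : R :=
  sum_n (fun n => (a (Z.of_nat n) + a (- Z.of_nat (S n))%Z)%R) N.

Lemma psum_S (a : Z -> R) (N : nat) :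
  psum a (S N) = (psum a N + (a (Z.of_nat (S N)) + a (- Z.of_nat (S (S N)))%Z))%R.
Proof. unfold psum. rewrite sum_Sn. reflexivity. Qed.

Lemma psum_lim (a : Z -> R) : SR a -> is_lim_seq (psum a) (sumR a).
Proof.
  intros [H1 H2]. apply ex_series_Rabs in H1. apply ex_series_Rabs in H2.
  exact (is_series_plus _ _ _ _ (Series_correct _ H1) (Series_correct _ H2)).
Qed.

Lemma psum_incr (a : Z -> R) (N : nat) : (forall n, (0 <= a n)%R) -> (psum a N <= psum a (S N))%R.
Proof.
  intro H. rewrite psum_S. pose proof (H (Z.of_nat (S N))). pose proof (H (- Z.of_nat (S (S N)))%Z).
  lra.
Qed.

Lemma psum_le_sumR (a : Z -> R) (N : nat) :
  (forall n, (0 <= a n)%R) -> SR a -> (psum a N <= sumR a)%R.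
Proof.
  intros H Ha. apply (is_lim_seq_incr_compare (psum a) (sumR a) (psum_lim a Ha)).
  intro k. apply psum_incr, H.
Qed.

Lemma psum_bounded (a : Z -> R) (M : R) :
  (forall n, (0 <= a n)%R) -> (forall N, (psum a N <= M)%R) -> SR a /\ (sumR a <= M)%R.
Proof.
  intros H HM.
  assert (E : ex_series (fun n => (a (Z.of_nat n) + a (- Z.of_nat (S n))%Z)%R)).
  { destruct (ex_finite_lim_seq_incr (psum a) M) as [l Hl].
    - intro n. apply psum_incr, H.
    - exact HM.
    - exists l. exact Hl. }
  assert (S : SR a).
  { split; apply (ex_series_le (K := R_AbsRing) (V := R_CompleteNormedModule)) with (2 := E);
    intro n; unfold norm; simpl; unfold abs; simpl;
    rewrite Rabs_Rabsolu, Rabs_pos_eq by apply H;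
    pose proof (H (Z.of_nat n)); pose proof (H (- Z.of_nat (S n))%Z); simpl in *; lra. }
  split; [exact S |].
  apply (is_lim_seq_le (psum a) (fun _ => M) (sumR a) M); [exact HM | apply psum_lim, S | apply is_lim_seq_const].
Qed.

Lemma term_le_psum (a : Z -> R) (m : Z) :
  (forall n, (0 <= a n)%R) -> exists N, (a m <= psum a N)%R.
Proof.
  intro H.
  assert (P : forall N, (0 <= psum a N)%R).
  { induction N as [|N IH].
    - unfold psum. rewrite sum_O. pose proof (H (Z.of_nat 0)). pose proof (H (- Z.of_nat 1)%Z). lra.
    - eapply Rle_trans; [exact IH | apply psum_incr, H]. }
  assert (Q : forall N, (a (Z.of_nat N) <= psum a N)%R /\ (a (- Z.of_nat (S N))%Z <= psum a N)%R).
  { intros [|N].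
    - unfold psum. rewrite sum_O. pose proof (H (Z.of_nat 0)). pose proof (H (- Z.of_nat 1)%Z). split; lra.
    - rewrite psum_S. pose proof (P N). pose proof (H (Z.of_nat (S N))).
      pose proof (H (- Z.of_nat (S (S N)))%Z). split; lra. }
  destruct (Z_le_gt_dec 0 m) as [Hm|Hm].
  - exists (Z.to_nat m). replace m with (Z.of_nat (Z.to_nat m)) at 1 by lia. apply Q.
  - exists (Z.to_nat (- m - 1)).
    replace m with (- Z.of_nat (S (Z.to_nat (- m - 1))))%Z at 1 by lia. apply Q.
Qed.

Lemma term_le_sumR (a : Z -> R) (m : Z) :
  (forall n, (0 <= a n)%R) -> SR a -> (a m <= sumR a)%R.
Proof.
  intros H Ha. destruct (term_le_psum a m H) as [N HN].
  eapply Rle_trans; [exact HN | apply psum_le_sumR; assumption].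
Qed.

Lemma sumR_zero : sumR (fun _ => 0%R) = 0%R.
Proof.
  transitivity (0 * sumR (fun _ => 0))%R; [| ring].
  rewrite <- sumR_scal. f_equal. apply functional_extensionality; intro; ring.
Qed.

Lemma is_series_head (a : nat -> R) : (forall n, a (S n) = 0%R) -> is_series a (a 0%nat).
Proof.
  intro H. change (is_lim_seq (sum_n a) (a 0%nat)).
  apply is_lim_seq_ext with (fun _ => a 0%nat); [| apply is_lim_seq_const].
  induction n as [|n IH].
  - rewrite sum_O. reflexivity.
  - rewrite sum_Sn, <- IH, H. unfold plus; simpl; ring.
Qed.

Lemma sumR_single_aux (c : R) :
  SR (fun n => if Z.eq_dec n 0 then c else 0%R) /\
  sumR (fun n => if Z.eq_dec n 0 then c else 0%R) = c.
Proof.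
  split; [split |].
  - eexists. apply is_series_head. intro n.
    destruct (Z.eq_dec (Z.of_nat (S n)) 0); [lia | apply Rabs_R0].
  - eexists. apply is_series_head. intro n.
    destruct (Z.eq_dec (- Z.of_nat (S (S n))) 0); [lia | apply Rabs_R0].
  - unfold sumR. erewrite is_series_unique, is_series_unique.
    2:{ apply is_series_head. intro n.
        destruct (Z.eq_dec (- Z.of_nat (S (S n))) 0); [lia | reflexivity]. }
    2:{ apply is_series_head. intro n.
        destruct (Z.eq_dec (Z.of_nat (S n)) 0); [lia | reflexivity]. }
    simpl. ring.
Qed.

Lemma SR_single (m : Z) (c : R) : SR (fun n => if Z.eq_dec n m then c else 0%R).
Proof.
  pose proof (SR_sh m _ (proj1 (sumR_single_aux c))) as H. cbv beta in H.
  eapply eq_ind; [exact H |]. apply functional_extensionality; intro n.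
  destruct (Z.eq_dec (n - m) 0), (Z.eq_dec n m); lia || reflexivity.
Qed.

Lemma sumR_single (m : Z) (c : R) : sumR (fun n => if Z.eq_dec n m then c else 0%R) = c.
Proof.
  destruct (sumR_single_aux c) as [H1 H2]. transitivity (sumR (fun n => if Z.eq_dec n 0 then c else 0%R)).
  2: exact H2.
  rewrite <- (sumR_sh m _ H1). f_equal. apply functional_extensionality; intro n.
  destruct (Z.eq_dec (n - m) 0), (Z.eq_dec n m); lia || reflexivity.
Qed.

(** * The Hilbert space of Fourier coefficients *)

Definition addF (f g : Z -> C) : Z -> C := fun n => f n + g n.
Definition subF (f g : Z -> C) : Z -> C := fun n => f n - g n.
Definition scF (c : C) (f : Z -> C) : Z -> C := fun n => c * f n.
Definition zeroF : Z -> C := fun _ => 0.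
(** Multiplication by z^m. *)
Definition sh (m : Z) (f : Z -> C) : Z -> C := fun n => f (n - m)%Z.
(** Complex conjugation of a function on the circle. *)
Definition star (f : Z -> C) : Z -> C := fun n => Cconj (f (- n)%Z).
Definition e (m : Z) : Z -> C := fun n => if Z.eq_dec n m then 1 else 0.

Ltac fext := apply functional_extensionality; let n := fresh "n" in intro n.

Definition SC (a : Z -> C) : Prop := SR (fun n => Re (a n)) /\ SR (fun n => Im (a n)).

Lemma sumZ_sumR (a : Z -> C) : sumZ a = (sumR (fun n => Re (a n)), sumR (fun n => Im (a n))).
Proof. reflexivity. Qed.

Lemma sumZ_plus (a b : Z -> C) : SC a -> SC b -> sumZ (fun n => a n + b n) = sumZ a + sumZ b.
Proof.
  intros [H1 H2] [K1 K2]. rewrite !sumZ_sumR.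
  apply injective_projections; cbn [fst snd Cplus]; [rewrite <- (sumR_plus _ _ H1 K1) | rewrite <- (sumR_plus _ _ H2 K2)]; reflexivity.
Qed.

Lemma sumZ_scal (c : C) (a : Z -> C) : SC a -> sumZ (fun n => c * a n) = c * sumZ a.
Proof.
  intros [H1 H2]. rewrite !sumZ_sumR.
  pose proof (SR_scal (Re c) _ H1) as A1. pose proof (SR_scal (- Im c)%R _ H2) as A2.
  pose proof (SR_scal (Im c) _ H1) as A3. pose proof (SR_scal (Re c) _ H2) as A4.
  apply injective_projections; cbn [fst snd Cmult].
  - transitivity (sumR (fun n => (Re c * Re (a n) + - Im c * Im (a n))%R)).
    + f_equal. fext. unfold Re, Im; simpl; ring.
    + rewrite (sumR_plus _ _ A1 A2), !sumR_scal. unfold Re, Im; ring.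
  - transitivity (sumR (fun n => (Re c * Im (a n) + Im c * Re (a n))%R)).
    + f_equal; fext; unfold Re, Im; simpl; ring.
    + rewrite (sumR_plus _ _ A4 A3), !sumR_scal. unfold Re, Im; ring.
Qed.

Lemma sumZ_conj (a : Z -> C) : sumZ (fun n => Cconj (a n)) = Cconj (sumZ a).
Proof.
  rewrite !sumZ_sumR. unfold Cconj; cbn [fst snd]. f_equal.
  transitivity (sumR (fun n => (-1 * Im (a n))%R)).
  - f_equal. fext. unfold Im; simpl; ring.
  - rewrite sumR_scal. unfold Im; ring.
Qed.

Lemma sumZ_zero : sumZ (fun _ => 0) = 0.
Proof. rewrite sumZ_sumR. unfold Re, Im. simpl. rewrite sumR_zero. reflexivity. Qed.

Lemma L2_SR (f : Z -> C) : L2 f <-> SR (fun n => (Cmod (f n) ^ 2)%R).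
Proof.
  unfold L2, SR, posp, negp. split; (intros [H1 H2]; split);
  [eapply ex_series_ext; [| exact H1] | eapply ex_series_ext; [| exact H2]
  |eapply ex_series_ext; [| exact H1] | eapply ex_series_ext; [| exact H2]]; intro n; cbv beta;
  rewrite Rabs_pos_eq by apply pow2_ge_0; reflexivity.
Qed.

Lemma norm2_sumR (f : Z -> C) : norm2 f = sumR (fun n => (Cmod (f n) ^ 2)%R).
Proof. reflexivity. Qed.

Lemma Cmod2 (z : C) : (Cmod z ^ 2 = Re z * Re z + Im z * Im z)%R.
Proof. rewrite Cmod2_alt. ring. Qed.

Lemma Cmod2_ge0 (z : C) : (0 <= Cmod z ^ 2)%R.
Proof. apply pow2_ge_0. Qed.

Lemma Cmod2_conj_l (z : C) : Cconj z * z = RtoC (Cmod z ^ 2)%R.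
Proof. rewrite Cmod2_conj. ring. Qed.

Lemma Cmod2_conj_r (z : C) : z * Cconj z = RtoC (Cmod z ^ 2)%R.
Proof. rewrite Cmod2_conj. ring. Qed.

Lemma Cmod2_eq0 (z : C) : (Cmod z ^ 2 <= 0)%R -> z = 0.
Proof. intro H. apply Cmod_eq_0. pose proof (Cmod_ge_0 z). nra. Qed.

Lemma L2_add (f g : Z -> C) : L2 f -> L2 g -> L2 (addF f g).
Proof.
  rewrite !L2_SR. intros H K.
  apply SR_le with (fun n => (2 * Cmod (f n) ^ 2 + 2 * Cmod (g n) ^ 2)%R).
  - intro n. rewrite Rabs_pos_eq by apply pow2_ge_0. rewrite !Cmod2. unfold addF, Re, Im; simpl.
    pose proof (pow2_ge_0 (fst (f n) - fst (g n))). pose proof (pow2_ge_0 (snd (f n) - snd (g n))). nra.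
  - apply (SR_plus _ _ (SR_scal 2 _ H) (SR_scal 2 _ K)).
Qed.

Lemma L2_sc (c : C) (f : Z -> C) : L2 f -> L2 (scF c f).
Proof.
  rewrite !L2_SR. intros H. eapply eq_ind; [exact (SR_scal (Cmod c ^ 2) _ H) |].
  fext. unfold scF. rewrite Cmod_mult. ring.
Qed.

Lemma subF_eq (f g : Z -> C) : subF f g = addF f (scF (-1) g).
Proof. fext. unfold subF, addF, scF. ring. Qed.

Lemma L2_sub (f g : Z -> C) : L2 f -> L2 g -> L2 (subF f g).
Proof. intros. rewrite subF_eq. apply L2_add, L2_sc; assumption. Qed.

Lemma L2_sh (m : Z) (f : Z -> C) : L2 f -> L2 (sh m f).
Proof. rewrite !L2_SR. intro H. exact (SR_sh m _ H). Qed.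

Lemma L2_star (f : Z -> C) : L2 f -> L2 (star f).
Proof.
  rewrite !L2_SR. intro H. eapply eq_ind; [exact (SR_refl _ H) |].
  fext. unfold star. rewrite Cmod_conj. reflexivity.
Qed.

Lemma L2_e (m : Z) : L2 (e m).
Proof.
  rewrite L2_SR. eapply eq_ind; [exact (SR_single m 1) |].
  fext. unfold e. destruct (Z.eq_dec n m); rewrite ?Cmod_0, ?Cmod_1; ring.
Qed.

Lemma L2_zero : L2 zeroF.
Proof.
  replace zeroF with (scF 0 (e 0)); [apply L2_sc, L2_e |]. fext. unfold scF, zeroF. ring.
Qed.

#[local] Hint Resolve L2_add L2_sc L2_sub L2_sh L2_star L2_e L2_zero : l2.

Lemma SC_ip (f g : Z -> C) : L2 f -> L2 g -> SC (fun n => f n * Cconj (g n)).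
Proof.
  rewrite !L2_SR. intros H K. pose proof (SR_plus _ _ H K) as S.
  split; (eapply SR_le; [| exact S]); intro n; cbv beta; rewrite !Cmod2; unfold Re, Im; simpl;
  apply Rabs_le; split; 
  (* The eight squares give the arithmetic-geometric bound for each product of a coordinate of [f n]
     with one of [g n], in both signs. *)
  pose proof (pow2_ge_0 (fst (f n) - fst (g n))); pose proof (pow2_ge_0 (snd (f n) - snd (g n)));
  pose proof (pow2_ge_0 (fst (f n) + fst (g n))); pose proof (pow2_ge_0 (snd (f n) + snd (g n)));
  pose proof (pow2_ge_0 (fst (f n) + snd (g n))); pose proof (pow2_ge_0 (snd (f n) - fst (g n)));
  pose proof (pow2_ge_0 (fst (f n) - snd (g n))); pose proof (pow2_ge_0 (snd (f n) + fst (g n))); nra.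
Qed.

Lemma ip_conj (f g : Z -> C) : ip g f = Cconj (ip f g).
Proof.
  unfold ip. rewrite <- sumZ_conj. f_equal. fext. rewrite Cmult_conj, Cconj_conj. ring.
Qed.

Lemma ip_add_l (f g h : Z -> C) : L2 f -> L2 g -> L2 h -> ip (addF f g) h = ip f h + ip g h.
Proof.
  intros Hf Hg Hh. unfold ip. rewrite <- sumZ_plus by (apply SC_ip; assumption).
  f_equal. fext. unfold addF. ring.
Qed.

Lemma ip_sc_l (c : C) (f h : Z -> C) : L2 f -> L2 h -> ip (scF c f) h = c * ip f h.
Proof.
  intros Hf Hh. unfold ip. rewrite <- sumZ_scal by (apply SC_ip; assumption).
  f_equal. fext. unfold scF. ring.
Qed.

Lemma ip_add_r (f g h : Z -> C) : L2 f -> L2 g -> L2 h -> ip h (addF f g) = ip h f + ip h g.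
Proof.
  intros. rewrite (ip_conj (addF f g) h), ip_add_l, Cplus_conj, <- !ip_conj by assumption. reflexivity.
Qed.

Lemma ip_sc_r (c : C) (f h : Z -> C) : L2 f -> L2 h -> ip h (scF c f) = Cconj c * ip h f.
Proof.
  intros. rewrite (ip_conj (scF c f) h), ip_sc_l, Cmult_conj, <- !ip_conj by assumption. reflexivity.
Qed.

Lemma ip_sub_l (f g h : Z -> C) : L2 f -> L2 g -> L2 h -> ip (subF f g) h = ip f h - ip g h.
Proof. intros. rewrite subF_eq, ip_add_l, ip_sc_l by auto with l2. ring. Qed.

Lemma ip_sub_r (f g h : Z -> C) : L2 f -> L2 g -> L2 h -> ip h (subF f g) = ip h f - ip h g.
Proof.
  intros. rewrite (ip_conj (subF f g) h), ip_sub_l, Cminus_conj, <- !ip_conj by assumption. reflexivity.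
Qed.

Lemma ip_sh (m : Z) (f g : Z -> C) : L2 f -> L2 g -> ip (sh m f) (sh m g) = ip f g.
Proof.
  intros Hf Hg. destruct (SC_ip f g Hf Hg) as [H1 H2]. unfold ip. rewrite !sumZ_sumR.
  f_equal; [exact (sumR_sh m _ H1) | exact (sumR_sh m _ H2)].
Qed.

Lemma sh_sh (m k : Z) (f : Z -> C) : sh m (sh k f) = sh (m + k) f.
Proof. fext. unfold sh. f_equal. lia. Qed.

Lemma sh_0 (f : Z -> C) : sh 0 f = f.
Proof. fext. unfold sh. f_equal. lia. Qed.

Lemma ip_sh_l (m : Z) (f g : Z -> C) : L2 f -> L2 g -> ip (sh m f) g = ip f (sh (- m) g).
Proof.
  intros. rewrite <- (ip_sh m f (sh (- m) g)) by auto with l2.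
  rewrite sh_sh, Z.add_opp_diag_r, sh_0. reflexivity.
Qed.

Lemma ip_star (f g : Z -> C) : L2 f -> L2 g -> ip (star f) (star g) = ip g f.
Proof.
  intros Hf Hg. destruct (SC_ip g f Hg Hf) as [H1 H2]. unfold ip. rewrite !sumZ_sumR.
  f_equal; [rewrite <- (sumR_refl _ H1) | rewrite <- (sumR_refl _ H2)];
  f_equal; fext; unfold star; rewrite Cconj_conj; unfold Re, Im; simpl; ring.
Qed.

Lemma ip_e_r (f : Z -> C) (m : Z) : ip f (e m) = f m.
Proof.
  unfold ip. rewrite sumZ_sumR. rewrite (surjective_pairing (f m)).
  f_equal; [rewrite <- (sumR_single m (fst (f m))) | rewrite <- (sumR_single m (snd (f m)))];
  f_equal; fext; unfold e, Re, Im; destruct (Z.eq_dec n m) as [->|]; simpl; ring.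
Qed.

Lemma ip_e_l (f : Z -> C) (m : Z) : ip (e m) f = Cconj (f m).
Proof. rewrite ip_conj, ip_e_r. reflexivity. Qed.

Lemma ip_zero_l (f : Z -> C) : ip zeroF f = 0.
Proof. unfold ip. rewrite <- sumZ_zero. f_equal. fext. unfold zeroF. ring. Qed.

Lemma ip_zero_r (f : Z -> C) : ip f zeroF = 0.
Proof.
  rewrite ip_conj, ip_zero_l. unfold Cconj; simpl. rewrite Ropp_0. reflexivity.
Qed.

(** * Squared norms and the Cauchy-Schwarz inequality *)

Lemma ip_norm2 (f : Z -> C) : ip f f = RtoC (norm2 f).
Proof.
  unfold ip. rewrite sumZ_sumR, norm2_sumR. unfold RtoC. f_equal.
  - f_equal. fext. rewrite Cmod2. unfold Re, Im; simpl; ring.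
  - rewrite <- sumR_zero. f_equal. fext. unfold Re, Im; simpl; ring.
Qed.

Lemma norm2_ge0 (f : Z -> C) : L2 f -> (0 <= norm2 f)%R.
Proof.
  intro H. eapply Rle_trans; [apply (Cmod2_ge0 (f 0%Z)) |]. rewrite norm2_sumR.
  apply (term_le_sumR (fun n => (Cmod (f n) ^ 2)%R)); [intro; apply Cmod2_ge0 | apply L2_SR, H].
Qed.

Lemma norm2_coef (f : Z -> C) (m : Z) : L2 f -> (Cmod (f m) ^ 2 <= norm2 f)%R.
Proof.
  intro H. rewrite norm2_sumR.
  apply (term_le_sumR (fun n => (Cmod (f n) ^ 2)%R)); [intro; apply Cmod2_ge0 | apply L2_SR, H].
Qed.

Lemma norm2_eq0 (f : Z -> C) : L2 f -> (norm2 f <= 0)%R -> f = zeroF.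
Proof.
  intros H K. fext. apply Cmod2_eq0. pose proof (norm2_coef f n H). lra.
Qed.

Lemma norm2_add (f g : Z -> C) :
  L2 f -> L2 g -> norm2 (addF f g) = (norm2 f + norm2 g + 2 * Re (ip f g))%R.
Proof.
  intros Hf Hg. apply RtoC_inj. rewrite <- ip_norm2, ip_add_l, !ip_add_r by auto with l2.
  rewrite !ip_norm2, (ip_conj f g). apply injective_projections; unfold Re; simpl; ring.
Qed.

Lemma norm2_sc (c : C) (f : Z -> C) : L2 f -> norm2 (scF c f) = (Cmod c ^ 2 * norm2 f)%R.
Proof.
  intros Hf. apply RtoC_inj. rewrite <- ip_norm2, ip_sc_l, !ip_sc_r by auto with l2.
  rewrite ip_norm2, Cmult_assoc, Cmod2_conj_r, RtoC_mult. reflexivity.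
Qed.

Lemma norm2_sub (f g : Z -> C) :
  L2 f -> L2 g -> norm2 (subF f g) = (norm2 f + norm2 g - 2 * Re (ip f g))%R.
Proof.
  intros Hf Hg. rewrite subF_eq, norm2_add, norm2_sc, ip_sc_r by auto with l2.
  rewrite Cmod2. unfold Re, Im; simpl. ring.
Qed.

Lemma norm2_sh (m : Z) (f : Z -> C) : L2 f -> norm2 (sh m f) = norm2 f.
Proof. intro H. apply RtoC_inj. rewrite <- !ip_norm2. apply ip_sh; assumption. Qed.

Lemma norm2_star (f : Z -> C) : L2 f -> norm2 (star f) = norm2 f.
Proof. intro H. apply RtoC_inj. rewrite <- !ip_norm2. apply ip_star; assumption. Qed.

Lemma norm2_e (m : Z) : norm2 (e m) = 1%R.
Proof.
  apply RtoC_inj. rewrite <- ip_norm2, ip_e_r. unfold e. destruct (Z.eq_dec m m); congruence.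
Qed.

Lemma norm2_add_le (f g : Z -> C) :
  L2 f -> L2 g -> (norm2 (addF f g) <= 2 * norm2 f + 2 * norm2 g)%R.
Proof.
  intros Hf Hg. pose proof (norm2_ge0 _ (L2_sub _ _ Hf Hg)) as H.
  rewrite norm2_sub in H by assumption. rewrite norm2_add by assumption. lra.
Qed.

Lemma Cauchy_Schwarz (f g : Z -> C) :
  L2 f -> L2 g -> (Cmod (ip f g) ^ 2 <= norm2 f * norm2 g)%R.
Proof.
  intros Hf Hg. destruct (Rle_lt_dec (norm2 g) 0) as [H0|H0].
  - rewrite (norm2_eq0 g Hg H0), ip_zero_r, Cmod_0.
    (* The rewrite turned every [g] into [zeroF]; going back makes the right-hand side a product of
       two non-negative norms again. *)
    rewrite <- (norm2_eq0 g Hg H0).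
    pose proof (norm2_ge0 f Hf). pose proof (norm2_ge0 g Hg). nra.
  - pose proof (norm2_ge0 _ (L2_sub _ _ Hf (L2_sc (ip f g / RtoC (norm2 g)) _ Hg))) as H.
    rewrite norm2_sub, norm2_sc, ip_sc_r in H by auto with l2.
    assert (Hn : RtoC (norm2 g) <> 0) by (intro K; apply RtoC_inj in K; lra).
    rewrite Cmod_div in H by exact Hn. rewrite Cmod_R, (Rabs_pos_eq (norm2 g)) in H by lra.
    rewrite Cdiv_conj in H by exact Hn.
    replace (Re (Cconj (ip f g) / Cconj (RtoC (norm2 g)) * ip f g)) with (Cmod (ip f g) ^ 2 / norm2 g)%R in H.
    + apply Rmult_le_reg_r with (/ norm2 g)%R; [apply Rinv_0_lt_compat, H0 |].
      replace ((Cmod (ip f g) / norm2 g) ^ 2 * norm2 g)%R with (Cmod (ip f g) ^ 2 / norm2 g)%R in H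
        by (field; lra).
      replace (norm2 f * norm2 g * / norm2 g)%R with (norm2 f) by (field; lra). unfold Rdiv in H. lra.
    + replace (Cconj (RtoC (norm2 g))) with (RtoC (norm2 g))
        by (apply injective_projections; simpl; ring).
      replace (Cconj (ip f g) / norm2 g * ip f g) with (RtoC (Cmod (ip f g) ^ 2 / norm2 g)%R); [reflexivity |].
      rewrite RtoC_div by lra. rewrite <- Cmod2_conj_l. field. exact Hn.
Qed.

(** The window is half-open so that passing from K to S K adds the indices K and -(S K), the same
    pair that one step of [psum] adds. *)
Definition cut (K : nat) (f : Z -> C) : Z -> C :=
  fun n => if (Z.leb (- Z.of_nat K) n && Z.ltb n (Z.of_nat K))%bool then f n else 0.

Ltac zcases := repeat match goal with
  | |- context [Z.leb ?x ?y] => destruct (Z.leb_spec x y)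
  | |- context [Z.ltb ?x ?y] => destruct (Z.ltb_spec x y)
  | |- context [Z.eq_dec ?x ?y] => destruct (Z.eq_dec x y)
  end; cbn [andb]; try lia.

Lemma cut_0 (f : Z -> C) : cut 0 f = zeroF.
Proof. fext. unfold cut, zeroF. zcases; reflexivity. Qed.

Lemma cut_S (K : nat) (f : Z -> C) :
  cut (S K) f = addF (addF (cut K f) (scF (f (Z.of_nat K)) (e (Z.of_nat K))))
                     (scF (f (- Z.of_nat (S K))%Z) (e (- Z.of_nat (S K)))).
Proof. fext. unfold cut, addF, scF, e. zcases; subst; ring. Qed.

Lemma L2_cut (K : nat) (f : Z -> C) : L2 (cut K f).
Proof. induction K; [rewrite cut_0 | rewrite cut_S]; auto with l2. Qed.
#[local] Hint Resolve L2_cut : l2.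

Lemma norm2_drop (g : Z -> C) (m : Z) :
  L2 g -> norm2 (subF g (scF (g m) (e m))) = (norm2 g - Cmod (g m) ^ 2)%R.
Proof.
  intro H. rewrite norm2_sub, norm2_sc, ip_sc_r, ip_e_r, norm2_e, Cmod2_conj_l by auto with l2.
  unfold Re, RtoC; simpl. ring.
Qed.

Lemma tail_S (K : nat) (f : Z -> C) :
  subF f (cut (S K) f) =
  subF (subF (subF f (cut K f)) (scF (f (Z.of_nat K)) (e (Z.of_nat K))))
       (scF (f (- Z.of_nat (S K))%Z) (e (- Z.of_nat (S K)))).
Proof. rewrite cut_S. fext. unfold subF, addF. ring. Qed.

Lemma norm2_tail_S (K : nat) (f : Z -> C) : L2 f ->
  norm2 (subF f (cut (S K) f)) =
  (norm2 (subF f (cut K f)) - Cmod (f (Z.of_nat K)) ^ 2 - Cmod (f (- Z.of_nat (S K))%Z) ^ 2)%R.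
Proof.
  intro H. rewrite tail_S.
  set (g := subF f (cut K f)).
  assert (E1 : f (Z.of_nat K) = g (Z.of_nat K)) by (unfold g, subF, cut; zcases; ring).
  set (g1 := subF g (scF (f (Z.of_nat K)) (e (Z.of_nat K)))).
  assert (E2 : f (- Z.of_nat (S K))%Z = g1 (- Z.of_nat (S K))%Z)
    by (unfold g1, g, subF, scF, cut, e; zcases; ring).
  assert (Hg : L2 g) by (unfold g; auto with l2).
  assert (Hg1 : L2 g1) by (unfold g1; auto with l2).
  rewrite E2, norm2_drop by exact Hg1. unfold g1. rewrite E1, norm2_drop by exact Hg. ring.
Qed.

(** Pythagoras, one basis vector at a time. The window [cut (S K)] matches [psum] at K because
    [sum_n] includes its last index. *)
Lemma norm2_tail (K : nat) (f : Z -> C) : L2 f ->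
  norm2 (subF f (cut (S K) f)) = (norm2 f - psum (fun n => (Cmod (f n) ^ 2)%R) K)%R.
Proof.
  intro H. induction K as [|K IH].
  - rewrite norm2_tail_S by exact H. rewrite cut_0.
    replace (subF f zeroF) with f by (fext; unfold subF, zeroF; ring).
    unfold psum. rewrite sum_O. ring.
  - rewrite norm2_tail_S, IH, psum_S by exact H. ring.
Qed.

Lemma tail_lim (f : Z -> C) : L2 f -> is_lim_seq (fun K => norm2 (subF f (cut (S K) f))) 0%R.
Proof.
  intro H. eapply is_lim_seq_ext; [intro K; symmetry; apply norm2_tail, H |].
  replace 0%R with (norm2 f - norm2 f)%R by ring.
  apply is_lim_seq_minus'; [apply is_lim_seq_const |].
  apply psum_lim, L2_SR, H.
Qed.

(* Replaces Fubini: two bounded operations on L^2 agree as soon as they agree on the basis. *)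
Lemma L2_dense (L : (Z -> C) -> C) (M : R) :
  (forall f g, L2 f -> L2 g -> L (addF f g) = L f + L g) ->
  (forall f, L2 f -> (Cmod (L f) ^ 2 <= M * norm2 f)%R) ->
  (forall c m, L (scF c (e m)) = 0) ->
  forall f, L2 f -> L f = 0.
Proof.
  intros Hadd Hb He f Hf.
  assert (HK : forall K, L (cut K f) = 0).
  { induction K as [|K IH].
    - rewrite cut_0. replace zeroF with (scF 0 (e 0)); [apply He |]. fext. unfold scF, zeroF. ring.
    - rewrite cut_S, !Hadd, IH, !He by auto with l2. ring. }
  apply Cmod2_eq0.
  apply (is_lim_seq_le (fun _ => Cmod (L f) ^ 2)%R
           (fun K => M * norm2 (subF f (cut (S K) f)))%R (Cmod (L f) ^ 2)%R 0%R).
  (* [L] vanishes on the window, so [L f] is the value at the tail, whose norm tends to 0. *)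
  - intro K. replace (L f) with (L (subF f (cut (S K) f))); [apply Hb; auto with l2 |].
    transitivity (L (addF (cut (S K) f) (subF f (cut (S K) f)))).
    + rewrite Hadd, HK by auto with l2. ring.
    + f_equal. fext. unfold addF, subF. ring.
  - apply is_lim_seq_const.
  - pose proof (is_lim_seq_scal_l _ M _ (tail_lim f Hf)) as Hl. simpl in Hl. rewrite Rmult_0_r in Hl. exact Hl.
Qed.

(** * Limits of complex sequences and completeness of L^2 *)

Definition cvC (u : nat -> C) (l : C) : Prop :=
  is_lim_seq (fun N => Re (u N)) (Re l) /\ is_lim_seq (fun N => Im (u N)) (Im l).

Lemma cvC_bound (u : nat -> C) (l : C) (v : nat -> R) :
  (forall N, (Cmod (u N - l) ^ 2 <= v N)%R) -> is_lim_seq v 0%R -> cvC u l.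
Proof.
  intros H Hv.
  assert (Hs : is_lim_seq (fun N => sqrt (v N)) 0%R).
  { rewrite <- sqrt_0. apply is_lim_seq_continuous; [apply continuity_pt_sqrt; lra | exact Hv]. }
  assert (Hr : forall N, (Rabs (Re (u N) - Re l) <= sqrt (v N))%R /\ (Rabs (Im (u N) - Im l) <= sqrt (v N))%R).
  { intro N. specialize (H N). rewrite Cmod2 in H. unfold Re, Im in *; simpl in H.
    rewrite <- (sqrt_Rsqr_abs (fst (u N) - fst l)), <- (sqrt_Rsqr_abs (snd (u N) - snd l)). unfold Rsqr.
    pose proof (Rle_0_sqr (fst (u N) - fst l)) as Q1. pose proof (Rle_0_sqr (snd (u N) - snd l)) as Q2.
    unfold Rsqr in Q1, Q2. split; apply sqrt_le_1_alt; unfold Rminus in *; lra. }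
  assert (Hc : forall (a : nat -> R) (b : R),
    (forall N, (Rabs (a N - b) <= sqrt (v N))%R) -> is_lim_seq a b).
  { intros a b Hab.
    apply is_lim_seq_le_le with (fun N => b - sqrt (v N))%R (fun N => b + sqrt (v N))%R.
    - intro N. specialize (Hab N). apply Rabs_le_between in Hab. lra.
    - replace (Finite b) with (Finite (b - 0)) by (f_equal; ring).
      apply is_lim_seq_minus'; [apply is_lim_seq_const | exact Hs].
    - replace (Finite b) with (Finite (b + 0)) by (f_equal; ring).
      apply is_lim_seq_plus'; [apply is_lim_seq_const | exact Hs]. }
  split; apply Hc; intro N; apply Hr.
Qed.

Lemma cvC_unique (u : nat -> C) (l l' : C) : cvC u l -> cvC u l' -> l = l'.
Proof.
  intros [H1 H2] [K1 K2]. apply is_lim_seq_unique in H1, H2, K1, K2.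
  apply injective_projections; unfold Re, Im in *; congruence.
Qed.

Lemma cvC_const (l : C) : cvC (fun _ => l) l.
Proof. split; apply is_lim_seq_const. Qed.

Lemma psum_0 (a : Z -> R) : psum a 0 = (a (Z.of_nat 0) + a (- Z.of_nat 1)%Z)%R.
Proof. unfold psum. rewrite sum_O. reflexivity. Qed.

(** Each [psum] involves finitely many coefficients, so the bound survives coefficientwise
    convergence; the supremum over windows then gives membership in L^2 as well as the norm
    bound. *)
Lemma Fatou (F : nat -> Z -> C) (f : Z -> C) (M : R) :
  (forall N, L2 (F N)) -> (forall N, (norm2 (F N) <= M)%R) ->
  (forall n, cvC (fun N => F N n) (f n)) -> L2 f /\ (norm2 f <= M)%R.
Proof.
  intros H2 HM Hc.
  assert (Hsq : forall n, is_lim_seq (fun N => (Cmod (F N n) ^ 2)%R) (Cmod (f n) ^ 2)%R).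
  { intro n. destruct (Hc n) as [H1 H3]. rewrite Cmod2.
    eapply is_lim_seq_ext; [intro N; symmetry; apply Cmod2 |].
    apply is_lim_seq_plus'; apply is_lim_seq_mult'; assumption. }
  rewrite L2_SR, norm2_sumR. apply (psum_bounded (fun n => (Cmod (f n) ^ 2)%R)); [intro; apply Cmod2_ge0 |].
  intro K. 
  apply (is_lim_seq_le (fun N => psum (fun n => (Cmod (F N n) ^ 2)%R) K) (fun _ => M)
     (psum (fun n => (Cmod (f n) ^ 2)%R) K) M).
  - intro N. eapply Rle_trans; [| apply (HM N)]. rewrite norm2_sumR.
    apply (psum_le_sumR (fun n => (Cmod (F N n) ^ 2)%R)); [intro; apply Cmod2_ge0 | apply L2_SR, H2].
  - induction K as [|K IH].
    + eapply is_lim_seq_ext; [intro N; symmetry; apply psum_0 |]. rewrite psum_0.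
      apply is_lim_seq_plus'; apply Hsq.
    + eapply is_lim_seq_ext; [intro N; symmetry; apply psum_S |]. rewrite psum_S.
      apply is_lim_seq_plus'; [exact IH |]. apply is_lim_seq_plus'; apply Hsq.
  - apply is_lim_seq_const.
Qed.

Lemma Rabs_lt_of_sq (x y : R) : (0 < y)%R -> (x ^ 2 < y ^ 2)%R -> (Rabs x < y)%R.
Proof. intros Hy H. apply Rabs_def1; nra. Qed.

(** The rate [v] is carried along because the later limit arguments need an explicit bound on the
    distance to the limit. *)
Lemma L2_complete (F : nat -> Z -> C) (v : nat -> R) :
  (forall N, L2 (F N)) ->
  (forall N k, (norm2 (subF (F (N + k)%nat) (F N)) <= v N)%R) -> is_lim_seq v 0%R ->
  exists f, L2 f /\ forall N, (norm2 (subF f (F N)) <= v N)%R.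
Proof.
  intros H2 Hv Hl.
  assert (Hco : forall n N k, (Cmod (F (N + k)%nat n - F N n) ^ 2 <= v N)%R).
  { intros n N k. eapply Rle_trans; [| apply (Hv N k)].
    apply (norm2_coef (subF (F (N + k)%nat) (F N)) n). auto with l2. }
  (* [p] stands for [Re] and for [Im], which are treated at once. *)
  assert (Hlim : forall p : C -> R, (forall a b, ((p a - p b) ^ 2 <= Cmod (a - b) ^ 2)%R) ->
     forall n, is_lim_seq (fun N => p (F N n)) (real (Lim_seq (fun N => p (F N n))))).
  { intros p Hp n. apply Lim_seq_correct', ex_lim_seq_cauchy_corr. intro eps.
    apply is_lim_seq_spec in Hl.
    assert (Hpos : (0 < (eps / 2) ^ 2)%R) by (apply pow_lt; pose proof (cond_pos eps); lra).
    destruct (Hl (mkposreal _ Hpos)) as [N0 HN0]. exists N0.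
    assert (Hc : forall m, (N0 <= m)%nat -> (Rabs (p (F m n) - p (F N0 n)) < eps / 2)%R).
    { intros m Hm. specialize (HN0 N0 (Nat.le_refl _)). simpl in HN0. rewrite Rminus_0_r in HN0.
      apply Rabs_def2 in HN0. specialize (Hp (F m n) (F N0 n)).
      specialize (Hco n N0 (m - N0)%nat). replace (N0 + (m - N0))%nat with m in Hco by lia.
      apply Rabs_lt_of_sq; [pose proof (cond_pos eps); lra | lra]. }
    intros m k Hm Hk. pose proof (Hc m Hm) as A1. pose proof (Hc k Hk) as A2.
    apply Rabs_def2 in A1, A2. apply Rabs_def1; lra. }
  set (f := fun n => (real (Lim_seq (fun N => Re (F N n))), real (Lim_seq (fun N => Im (F N n)))) : C).
  assert (Hf : forall n, cvC (fun N => F N n) (f n)).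
  { intro n. split; unfold f; simpl; apply (Hlim _); intros a b; rewrite Cmod2; unfold Re, Im; simpl;
    pose proof (pow2_ge_0 (fst a - fst b)); pose proof (pow2_ge_0 (snd a - snd b)); nra. }
  (* With N fixed, [Fatou] is applied in k to the differences of [F (N + k)] and [F N]. *)
  assert (Hd : forall N, L2 (subF f (F N)) /\ (norm2 (subF f (F N)) <= v N)%R).
  { intro N. apply (Fatou (fun k => subF (F (N + k)%nat) (F N))).
    - auto with l2.
    - apply Hv.
    - intro n. destruct (Hf n) as [A1 A2].
      apply (is_lim_seq_incr_n _ N) in A1. apply (is_lim_seq_incr_n _ N) in A2.
      split; unfold subF, Re, Im in *; simpl; (apply is_lim_seq_minus'; [| apply is_lim_seq_const]).
      + eapply is_lim_seq_ext; [| exact A1]. intro k. cbv beta. rewrite Nat.add_comm. reflexivity.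
      + eapply is_lim_seq_ext; [| exact A2]. intro k. cbv beta. rewrite Nat.add_comm. reflexivity. }
  exists f. split; [| apply Hd].
  replace f with (addF (subF f (F 0%nat)) (F 0%nat)) by (fext; unfold addF, subF; ring).
  apply L2_add; [apply Hd | apply H2].
Qed.

(** * Products *)

Lemma star_star (f : Z -> C) : star (star f) = f.
Proof. fext. unfold star. rewrite Cconj_conj. f_equal. lia. Qed.

Lemma star_sh (m : Z) (f : Z -> C) : star (sh m f) = sh (- m) (star f).
Proof. fext. unfold star, sh. do 2 f_equal. lia. Qed.

(** Through this formula, bounds on products come from Cauchy-Schwarz and linearity from that of
    [ip]. *)
Lemma mulF_ip (phi f : Z -> C) (n : Z) : mulF phi f n = ip phi (sh n (star f)).
Proof.
  unfold mulF, ip. f_equal. fext. unfold sh, star. rewrite Cconj_conj. do 2 f_equal. lia.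
Qed.

Lemma mulF_bound (phi f : Z -> C) (n : Z) :
  L2 phi -> L2 f -> (Cmod (mulF phi f n) ^ 2 <= norm2 phi * norm2 f)%R.
Proof.
  intros Hp Hf. rewrite mulF_ip.
  eapply Rle_trans; [apply Cauchy_Schwarz; auto with l2 |].
  rewrite norm2_sh, norm2_star by auto with l2. lra.
Qed.

Lemma mulF_comm (phi f : Z -> C) : L2 phi -> L2 f -> mulF phi f = mulF f phi.
Proof.
  intros Hp Hf. fext. rewrite !mulF_ip.
  rewrite <- (Z.opp_involutive n) at 1. rewrite <- ip_sh_l by auto with l2.
  rewrite <- (star_star (sh (- n) phi)), ip_star, star_sh, Z.opp_involutive by auto with l2.
  reflexivity.
Qed.

Lemma mulF_sh_r (phi f : Z -> C) (m : Z) : mulF phi (sh m f) = sh m (mulF phi f).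
Proof. fext. unfold mulF, sh. f_equal. fext. do 2 f_equal. lia. Qed.

Lemma mulF_e (phi : Z -> C) (m : Z) : L2 phi -> mulF phi (e m) = sh m phi.
Proof.
  intro H. fext. rewrite mulF_ip.
  replace (sh n (star (e m))) with (e (n - m)).
  - rewrite ip_e_r. reflexivity.
  - fext. unfold sh, star, e. zcases; unfold Cconj; simpl; rewrite Ropp_0; reflexivity.
Qed.

Lemma mulF_e_l (m : Z) (f : Z -> C) : L2 f -> mulF (e m) f = sh m f.
Proof. intro H. rewrite mulF_comm, mulF_e by auto with l2. reflexivity. Qed.

Lemma mulF_add_l (phi psi f : Z -> C) : L2 phi -> L2 psi -> L2 f ->
  mulF (addF phi psi) f = addF (mulF phi f) (mulF psi f).
Proof. intros. fext. unfold addF at 2. rewrite !mulF_ip, ip_add_l by auto with l2. reflexivity. Qed.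

Lemma mulF_sc_l (c : C) (phi f : Z -> C) : L2 phi -> L2 f ->
  mulF (scF c phi) f = scF c (mulF phi f).
Proof. intros. fext. unfold scF at 2. rewrite !mulF_ip, ip_sc_l by auto with l2. reflexivity. Qed.

Lemma mulF_add_r (phi f g : Z -> C) : L2 phi -> L2 f -> L2 g ->
  mulF phi (addF f g) = addF (mulF phi f) (mulF phi g).
Proof.
  intros. rewrite mulF_comm, mulF_add_l, (mulF_comm f), (mulF_comm g) by auto with l2. reflexivity.
Qed.

Lemma mulF_sc_r (c : C) (phi f : Z -> C) : L2 phi -> L2 f ->
  mulF phi (scF c f) = scF c (mulF phi f).
Proof. intros. rewrite mulF_comm, mulF_sc_l, (mulF_comm f) by auto with l2. reflexivity. Qed.

Lemma mulF_sub_r (phi f g : Z -> C) : L2 phi -> L2 f -> L2 g ->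
  mulF phi (subF f g) = subF (mulF phi f) (mulF phi g).
Proof. intros. rewrite !subF_eq, mulF_add_r, mulF_sc_r by auto with l2. reflexivity. Qed.

Lemma mulF_sub_l (phi psi f : Z -> C) : L2 phi -> L2 psi -> L2 f ->
  mulF (subF phi psi) f = subF (mulF phi f) (mulF psi f).
Proof. intros. rewrite !subF_eq, mulF_add_l, mulF_sc_l by auto with l2. reflexivity. Qed.

Lemma star_mulF (phi f : Z -> C) : L2 phi -> L2 f -> star (mulF phi f) = mulF (star phi) (star f).
Proof.
  intros. fext. unfold star at 1. rewrite !mulF_ip, <- ip_conj.
  rewrite <- ip_star, star_sh, Z.opp_involutive by auto with l2. 
  reflexivity.
Qed.

Lemma Cmod_sub_sq (a b : C) : (Cmod (a - b) ^ 2 <= 2 * Cmod a ^ 2 + 2 * Cmod b ^ 2)%R.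
Proof.
  rewrite !Cmod2. unfold Re, Im; simpl.
  pose proof (pow2_ge_0 (fst a + fst b)). pose proof (pow2_ge_0 (snd a + snd b)). nra.
Qed.

(** [L2_dense] applied to each coefficient of the difference. It requires no linearity over C, only
    additivity and agreement on all multiples of the basis vectors. *)
Lemma op_dense (T1 T2 : (Z -> C) -> Z -> C) (M : R) :
  (forall f g, L2 f -> L2 g -> T1 (addF f g) = addF (T1 f) (T1 g)) ->
  (forall f g, L2 f -> L2 g -> T2 (addF f g) = addF (T2 f) (T2 g)) ->
  (forall f, L2 f -> L2 (T1 f) /\ (norm2 (T1 f) <= M * norm2 f)%R) ->
  (forall f, L2 f -> L2 (T2 f) /\ (norm2 (T2 f) <= M * norm2 f)%R) ->
  (forall c m, T1 (scF c (e m)) = T2 (scF c (e m))) ->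
  forall f, L2 f -> T1 f = T2 f.
Proof.
  intros A1 A2 B1 B2 He f Hf. fext.
  enough (H : T1 f n - T2 f n = 0) by (rewrite <- (Cplus_0_r (T2 f n)), <- H; ring).
  apply (L2_dense (fun g => T1 g n - T2 g n) (4 * M)%R); [| | | exact Hf].
  - intros g h Hg Hh. rewrite A1, A2 by assumption. unfold addF. ring.
  - intros g Hg. destruct (B1 g Hg) as [C1 D1]. destruct (B2 g Hg) as [C2 D2].
    pose proof (Cmod_sub_sq (T1 g n) (T2 g n)).
    pose proof (norm2_coef _ n C1). pose proof (norm2_coef _ n C2). lra.
  - intros c m. rewrite He. ring.
Qed.

(** * Bounded multipliers *)

(** The symbols in L^infinity, encoded by the boundedness of multiplication, since coefficients give
    no direct access to an essential supremum. *)
Definition multiplier (phi : Z -> C) : Prop :=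
  L2 phi /\ exists M, (0 <= M)%R /\
    forall f, L2 f -> L2 (mulF phi f) /\ (norm2 (mulF phi f) <= M * norm2 f)%R.

Lemma mult_L2 (phi : Z -> C) : multiplier phi -> L2 phi.
Proof. intros [H _]. exact H. Qed.

Lemma L2_mulF (phi f : Z -> C) : multiplier phi -> L2 f -> L2 (mulF phi f).
Proof. intros [_ [M [_ H]]] Hf. apply H, Hf. Qed.

#[local] Hint Resolve mult_L2 L2_mulF : l2.

Lemma mult_star (phi : Z -> C) : multiplier phi -> multiplier (star phi).
Proof.
  intros [Hp [M [HM H]]]. split; [auto with l2 |]. exists M. split; [exact HM |].
  intros f Hf. rewrite <- (star_star f), <- star_mulF by auto with l2.
  destruct (H (star f)) as [H1 H2]; [auto with l2 |]. split; [auto with l2 |].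
  rewrite star_star, norm2_star by exact H1. rewrite norm2_star in H2 by exact Hf. exact H2.
Qed.

Lemma mult_e (m : Z) : multiplier (e m).
Proof.
  split; [auto with l2 |]. exists 1%R. split; [lra |]. intros f Hf.
  rewrite mulF_e_l, norm2_sh by exact Hf. split; [auto with l2 | lra].
Qed.

Lemma mult_add (phi psi : Z -> C) : multiplier phi -> multiplier psi -> multiplier (addF phi psi).
Proof.
  intros [Hp [M [HM H]]] [Kp [N [HN K]]]. split; [auto with l2 |].
  exists (2 * M + 2 * N)%R. split; [lra |]. intros f Hf.
  rewrite mulF_add_l by assumption. destruct (H f Hf) as [H1 H2]. destruct (K f Hf) as [K1 K2].
  split; [auto with l2 |]. pose proof (norm2_add_le _ _ H1 K1). lra.
Qed.

Lemma mult_sc (c : C) (phi : Z -> C) : multiplier phi -> multiplier (scF c phi).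
Proof.
  intros [Hp [M [HM H]]]. split; [auto with l2 |].
  exists (Cmod c ^ 2 * M)%R. pose proof (Cmod2_ge0 c). split; [nra |]. intros f Hf.
  rewrite mulF_sc_l by assumption. destruct (H f Hf) as [H1 H2].
  split; [auto with l2 |]. rewrite norm2_sc by exact H1. nra.
Qed.

Lemma mulF_adj (phi f g : Z -> C) : multiplier phi -> L2 f -> L2 g ->
  ip (mulF phi f) g = ip f (mulF (star phi) g).
Proof.
  intros Hp Hf Hg. pose proof (mult_star phi Hp) as Hm. destruct (Hm) as [Ls [M [HM Hs]]].
  assert (LF : L2 (mulF phi f)) by auto with l2.
  enough (H : ip (mulF phi f) g - ip f (mulF (star phi) g) = 0)
    by (rewrite <- (Cplus_0_r (ip f _)), <- H; ring).
  (* This functional is conjugate linear in [g]; [L2_dense] admits it because it asks for additivity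
     and for all multiples of basis vectors. *)
  apply (L2_dense (fun g => ip (mulF phi f) g - ip f (mulF (star phi) g))
           (2 * norm2 (mulF phi f) + 2 * (norm2 f * M))%R); [| | | exact Hg].
  - intros h k Hh Hk. rewrite mulF_add_r, !ip_add_r by auto with l2. ring.
  - intros h Hh. destruct (Hs h Hh) as [H1 H2].
    pose proof (Cmod_sub_sq (ip (mulF phi f) h) (ip f (mulF (star phi) h))).
    pose proof (Cauchy_Schwarz _ _ LF Hh). pose proof (Cauchy_Schwarz _ _ Hf H1).
    pose proof (norm2_ge0 _ Hf). nra.
  - intros c m. rewrite mulF_sc_r, !ip_sc_r, ip_e_r, mulF_e by auto with l2.
    rewrite (mulF_comm phi f), mulF_ip by auto with l2. ring.
Qed.

Lemma mult_bound2 (phi psi : Z -> C) : multiplier phi -> multiplier psi -> exists M, (0 <= M)%R /\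
  forall f, L2 f -> L2 (mulF phi (mulF psi f)) /\ (norm2 (mulF phi (mulF psi f)) <= M * norm2 f)%R.
Proof.
  intros [Hp [M [HM H]]] [Kp [N [HN K]]]. exists (M * N)%R. split; [nra |].
  intros f Hf. destruct (K f Hf) as [K1 K2]. destruct (H _ K1) as [H1 H2]. split; [exact H1 | nra].
Qed.

Lemma mulF_mulF_comm (phi psi f : Z -> C) : multiplier phi -> multiplier psi -> L2 f ->
  mulF phi (mulF psi f) = mulF psi (mulF phi f).
Proof.
  intros Hp Hq Hf. destruct (mult_bound2 _ _ Hp Hq) as [M [HM A]].
  destruct (mult_bound2 _ _ Hq Hp) as [N [HN B]].
  apply (op_dense (fun f => mulF phi (mulF psi f)) (fun f => mulF psi (mulF phi f)) (M + N)%R).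
  - intros. rewrite !mulF_add_r by auto with l2. reflexivity.
  - intros. rewrite !mulF_add_r by auto with l2. reflexivity.
  - intros g Hg. destruct (A g Hg). split; [assumption |]. pose proof (norm2_ge0 g Hg). nra.
  - intros g Hg. destruct (B g Hg). split; [assumption |]. pose proof (norm2_ge0 g Hg). nra.
  - intros c m. rewrite !mulF_sc_r, !mulF_e, !mulF_sh_r by auto with l2.
    rewrite (mulF_comm phi psi) by auto with l2. reflexivity.
  - exact Hf.
Qed.

(** Making the product a multiplier bounds the left-hand side in [f]; for unimodular factors
    [unimod_mulF] supplies this. *)
Lemma mulF_assoc (phi psi f : Z -> C) : multiplier phi -> multiplier psi -> multiplier (mulF phi psi) -> L2 f ->
  mulF (mulF phi psi) f = mulF phi (mulF psi f).
Proof.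
  intros Hp Hq Hpq Hf. destruct (mult_bound2 _ _ Hp Hq) as [M [HM A]].
  pose proof (mult_L2 _ Hpq) as LP. destruct Hpq as [_ [N [HN B]]].
  apply (op_dense (fun f => mulF (mulF phi psi) f) (fun f => mulF phi (mulF psi f)) (M + N)%R).
  - intros. rewrite !mulF_add_r by auto with l2. reflexivity.
  - intros. rewrite !mulF_add_r by auto with l2. reflexivity.
  - intros g Hg. destruct (B g Hg). split; [assumption |]. pose proof (norm2_ge0 g Hg). nra.
  - intros g Hg. destruct (A g Hg). split; [assumption |]. pose proof (norm2_ge0 g Hg). nra.
  - intros c m. rewrite !mulF_sc_r, !mulF_e, !mulF_sh_r by auto with l2. reflexivity.
  - exact Hf.
Qed.

(* [|theta| = 1] almost everywhere on the circle, read off the Fourier coefficients of [|theta|^2]. *)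
Definition unimod (theta : Z -> C) : Prop := L2 theta /\ forall n, ip (sh n theta) theta = e 0 n.

Lemma unimod_L2 (theta : Z -> C) : unimod theta -> L2 theta.
Proof. intros [H _]. exact H. Qed.
#[local] Hint Resolve unimod_L2 : l2.

Lemma unimod_sh (theta : Z -> C) (j m : Z) : unimod theta -> ip (sh j theta) (sh m theta) = e j m.
Proof.
  intros [H K]. replace j with (m + (j - m))%Z at 1 by lia.
  rewrite <- sh_sh, ip_sh, K by auto with l2. unfold e. zcases; reflexivity.
Qed.

Lemma unimod_star (theta : Z -> C) : unimod theta -> unimod (star theta).
Proof.
  intros H. split; [auto with l2 |]. intro n.
  rewrite <- (Z.opp_involutive n), <- star_sh, ip_star by auto with l2.
  rewrite <- (sh_0 theta) at 1. rewrite unimod_sh by exact H. unfold e. zcases; reflexivity.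
Qed.

(** The shifts of [theta] are orthonormal, so a window of [f] is sent to an expansion with the same
    coefficients. The three claims go together because the norm at the next window needs the inner
    products with the shifts being added. *)
Lemma unimod_cut (theta f : Z -> C) (K : nat) : unimod theta ->
  L2 (mulF theta (cut K f)) /\
  (forall m, ip (mulF theta (cut K f)) (sh m theta) = cut K f m) /\
  norm2 (mulF theta (cut K f)) = norm2 (cut K f).
Proof.
  intro H. induction K as [|K [I1 [I2 I3]]].
  - rewrite cut_0. replace (mulF theta zeroF) with zeroF.
    + split; [auto with l2 |]. split; [intro; apply ip_zero_l | reflexivity].
    + fext. unfold mulF. rewrite <- sumZ_zero at 1. unfold zeroF. f_equal. fext. ring.
  - assert (E : mulF theta (cut (S K) f) =
       addF (addF (mulF theta (cut K f)) (scF (f (Z.of_nat K)) (sh (Z.of_nat K) theta)))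
        (scF (f (- Z.of_nat (S K))%Z) (sh (- Z.of_nat (S K)) theta))).
    { rewrite cut_S, !mulF_add_r, !mulF_sc_r, !mulF_e by auto with l2. reflexivity. }
    rewrite E. assert (J : forall m, cut (S K) f m = cut K f m + f (Z.of_nat K) * e (Z.of_nat K) m
        + f (- Z.of_nat (S K))%Z * e (- Z.of_nat (S K)) m) by (intro; rewrite cut_S; reflexivity).
    split; [auto 6 with l2 |]. split.
    + intro m. rewrite !ip_add_l, !ip_sc_l, I2, !unimod_sh, J by auto with l2. reflexivity.
    + rewrite cut_S, !norm2_add, !norm2_sc, !ip_add_l, !ip_sc_r, !ip_sc_l, !I2, !unimod_sh, I3, !ip_e_r,
        !norm2_sh, !norm2_e by auto 6 with l2.
      replace (norm2 theta) with 1%R; [reflexivity |].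
      apply RtoC_inj. rewrite <- ip_norm2, <- (sh_0 theta), unimod_sh by exact H. reflexivity.
Qed.

Lemma unimod_mult (theta : Z -> C) : unimod theta -> multiplier theta.
Proof.
  intro H. split; [auto with l2 |]. exists 1%R. split; [lra |]. intros f Hf.
  (* Windows are mapped isometrically; [Fatou] carries the bound to the full product, which is not
     yet known to be square summable. *)
  rewrite Rmult_1_l. apply (Fatou (fun K => mulF theta (cut (S K) f))).
  - intro K. apply unimod_cut, H.
  - intro K. rewrite (proj2 (proj2 (unimod_cut theta f (S K) H))).
    rewrite (norm2_sumR f), (norm2_sumR (cut (S K) f)).
    pose proof (norm2_tail K f Hf) as HT.
    assert (HC : norm2 f = (norm2 (cut (S K) f) + norm2 (subF f (cut (S K) f)))%R).
    { assert (HI : forall J, ip (subF f (cut J f)) (cut J f) = 0).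
      { intro J. unfold ip. rewrite <- sumZ_zero. f_equal. fext. unfold subF, cut. zcases;
        apply injective_projections; simpl; ring. }
      replace f with (addF (cut (S K) f) (subF f (cut (S K) f))) at 1 by (fext; unfold addF, subF; ring).
      rewrite norm2_add, ip_conj, HI by auto with l2. unfold Re, Cconj; simpl. ring. }
    rewrite <- !norm2_sumR. pose proof (norm2_ge0 (subF f (cut (S K) f))) as P.
    assert (L2 (subF f (cut (S K) f))) by auto with l2. specialize (P H0). lra.
  - intro n. apply cvC_bound with (fun K => norm2 theta * norm2 (subF f (cut (S K) f)))%R.
    + intro K. replace (mulF theta (cut (S K) f) n - mulF theta f n)
        with (- mulF theta (subF f (cut (S K) f)) n).
      * rewrite Cmod_opp. apply mulF_bound; auto with l2.
      * rewrite mulF_sub_r by auto with l2. unfold subF. ring.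
    + pose proof (is_lim_seq_scal_l _ (norm2 theta) _ (tail_lim f Hf)) as Hl.
      simpl in Hl. rewrite Rmult_0_r in Hl. exact Hl.
Qed.
#[local] Hint Resolve unimod_mult mult_star mult_e mult_add mult_sc unimod_star : l2.

Lemma unimod_inv (theta f : Z -> C) : unimod theta -> L2 f -> mulF (star theta) (mulF theta f) = f.
Proof.
  intros H Hf. destruct (mult_bound2 (star theta) theta) as [M [HM A]]; [auto with l2 .. |].
  apply (op_dense (fun f => mulF (star theta) (mulF theta f)) (fun f => f) (M + 1)%R); [| | | | | exact Hf].
  - intros. rewrite !mulF_add_r by auto with l2. reflexivity.
  - reflexivity.
  - intros g Hg. destruct (A g Hg). split; [assumption |]. pose proof (norm2_ge0 g Hg). nra.
  - intros g Hg. split; [assumption |]. pose proof (norm2_ge0 g Hg). nra.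
  (* On a basis vector the claim reduces to conj(theta) theta = 1, whose coefficients are given by
     [unimod]. *)
  - intros c m. rewrite !mulF_sc_r, !mulF_e, !mulF_sh_r by auto with l2. f_equal.
    rewrite <- (sh_0 (e m)). replace (e m) with (sh m (e 0)) by (fext; unfold sh, e; zcases; reflexivity).
    rewrite sh_0. f_equal. fext. rewrite mulF_ip.
    rewrite <- (sh_0 (star theta)) at 1. rewrite unimod_sh by auto with l2. unfold e; zcases; reflexivity.
Qed.

Lemma unimod_inv' (theta f : Z -> C) : unimod theta -> L2 f -> mulF theta (mulF (star theta) f) = f.
Proof. intros. rewrite mulF_mulF_comm, unimod_inv by auto with l2. reflexivity. Qed.

Lemma unimod_isom (theta f g : Z -> C) : unimod theta -> L2 f -> L2 g ->
  ip (mulF theta f) (mulF theta g) = ip f g.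
Proof. intros. rewrite mulF_adj, unimod_inv by auto with l2. reflexivity. Qed.

Lemma unimod_mulF (theta psi : Z -> C) : unimod theta -> unimod psi -> unimod (mulF theta psi).
Proof.
  intros H K. split; [auto with l2 |]. intro n.
  rewrite <- mulF_sh_r, unimod_isom by auto with l2. apply K.
Qed.
#[local] Hint Resolve unimod_mulF : l2.

Lemma unimod_e (m : Z) : unimod (e m).
Proof.
  split; [auto with l2 |]. intro n. rewrite ip_e_r. unfold sh, e. zcases; reflexivity.
Qed.

Lemma unimod_sc (c : C) (theta : Z -> C) : Cmod c = 1%R -> unimod theta -> unimod (scF c theta).
Proof.
  intros Hc [H K]. split; [auto with l2 |]. intro n.
  replace (sh n (scF c theta)) with (scF c (sh n theta)) by reflexivity.
  rewrite ip_sc_l, ip_sc_r, K, Cmult_assoc, Cmod2_conj_r, Hc by auto with l2.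
  rewrite pow1. ring.
Qed.

Lemma unimod_limit (F : nat -> Z -> C) (f : Z -> C) (v : nat -> R) :
  (forall N, unimod (F N)) -> L2 f -> (forall N, (norm2 (subF f (F N)) <= v N)%R) ->
  is_lim_seq v 0%R -> unimod f.
Proof.
  intros HF Hf Hv Hl. split; [exact Hf |]. intro n.
  assert (HN : forall N, norm2 (F N) = 1%R).
  { intro N. apply RtoC_inj. rewrite <- ip_norm2, <- (sh_0 (F N)), unimod_sh by apply HF. reflexivity. }
  apply (cvC_unique (fun N => ip (sh n (F N)) (F N))).
  (* Change one argument of the inner product at a time: one error carries the factor [norm2 (F N)],
     which is 1, the other [norm2 f], and [Cmod_sub_sq] contributes the 2. *)
  - apply cvC_bound with (fun N => (2 * (norm2 f + 1)) * v N)%R.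
    + intro N. replace (ip (sh n (F N)) (F N) - ip (sh n f) f)
        with (ip (sh n (subF (F N) f)) (F N) - ip (sh n f) (subF f (F N))).
      * eapply Rle_trans; [apply Cmod_sub_sq |].
        pose proof (Cauchy_Schwarz (sh n (subF (F N) f)) (F N)) as A1.
        pose proof (Cauchy_Schwarz (sh n f) (subF f (F N))) as A2.
        rewrite HN, norm2_sh in A1 by auto with l2. rewrite norm2_sh in A2 by auto with l2.
        specialize (A1 ltac:(auto with l2) ltac:(auto with l2)).
        specialize (A2 ltac:(auto with l2) ltac:(auto with l2)).
        assert (E : norm2 (subF (F N) f) = norm2 (subF f (F N))).
        { rewrite !norm2_sub, (ip_conj f (F N)) by auto with l2. unfold Re, Cconj; simpl. ring. }
        specialize (Hv N). pose proof (norm2_ge0 f Hf). nra.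
      * replace (sh n (subF (F N) f)) with (subF (sh n (F N)) (sh n f)) by reflexivity.
        rewrite ip_sub_l, ip_sub_r by auto with l2. ring.
    + pose proof (is_lim_seq_scal_l _ (2 * (norm2 f + 1))%R _ Hl) as K.
      simpl in K. rewrite Rmult_0_r in K. exact K.
  - destruct (cvC_const (e 0 n)) as [A B]. split; (eapply is_lim_seq_ext; [| eassumption]);
    intro N; cbv beta; rewrite (proj2 (HF N)); reflexivity.
Qed.

(** * Reproducing kernels and Blaschke factors *)

(** The Szego kernel 1 / (1 - conj(a) z). *)
Definition ker (a : C) : Z -> C := fun n => if Z.leb 0 n then Cpow (Cconj a) (Z.to_nat n) else 0.

(* Point evaluation at [a] of the analytic function with Taylor coefficients [f]. *)
Definition ev (f : Z -> C) (a : C) : C := ip f (ker a).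

Lemma Cmod_pow2_lt1 (a : C) : (Cmod a < 1)%R -> (Cmod a ^ 2 < 1)%R.
Proof. intro H. pose proof (Cmod_ge_0 a). nra. Qed.

Lemma L2_ker (a : C) : (Cmod a < 1)%R -> L2 (ker a).
Proof.
  intro H. split.
  - eapply ex_series_ext; [| apply (ex_series_geom (Cmod a ^ 2))].
    + intro n. unfold posp, ker. zcases. rewrite Nat2Z.id, Cmod_pow, Cmod_conj, <- !pow_mult. f_equal. lia.
    + rewrite Rabs_pos_eq by apply Cmod2_ge0. apply Cmod_pow2_lt1, H.
  - eexists. apply is_series_head. intro n. unfold negp, ker. zcases.
    rewrite Cmod_0. ring.
Qed.
#[local] Hint Resolve L2_ker : l2.

Lemma ker_pow (a : C) (n : Z) (k : nat) :
  (0 <= n)%Z -> ker a (n + Z.of_nat k)%Z = Cpow (Cconj a) k * ker a n.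
Proof.
  intro H. unfold ker. zcases. rewrite Z2Nat.inj_add, Nat2Z.id, Cpow_add_r by lia. ring.
Qed.

(** The fixed-point form of the geometric series. Values of and pairings with kernels are computed
    below by solving the linear equation it produces. *)
Lemma ker_fix (a : C) : ker a = addF (e 0) (scF (Cconj a) (sh 1 (ker a))).
Proof.
  fext. unfold addF, scF, sh. destruct (Z_lt_le_dec n 1) as [H|H].
  - unfold ker, e. zcases; try subst n; simpl; ring.
  - replace n with ((n - 1) + Z.of_nat 1)%Z at 1 by lia. rewrite ker_pow by lia.
    unfold e. zcases. simpl. ring.
Qed.

Definition analytic (f : Z -> C) : Prop := forall n, (n < 0)%Z -> f n = 0.

Lemma ip_analytic_ext (f g h : Z -> C) : analytic f -> (forall n, (0 <= n)%Z -> g n = h n) -> ip f g = ip f h.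
Proof.
  intros Hf H. unfold ip. f_equal. fext. destruct (Z_lt_le_dec n 0).
  - rewrite Hf by assumption. ring.
  - rewrite H by assumption. reflexivity.
Qed.

(** [ev] sees only non-negative indices, and multiplication by z brings the coefficient at -1 into
    view; for analytic [f] that term is 0. *)
Lemma ev_sh1 (f : Z -> C) (a : C) : (Cmod a < 1)%R -> L2 f -> ev (sh 1 f) a = f (-1)%Z + a * ev f a.
Proof.
  intros Ha Hf. unfold ev. rewrite (ker_fix a) at 1.
  rewrite ip_add_r, ip_sc_r, ip_e_r, Cconj_conj, ip_sh by auto with l2. reflexivity.
Qed.

Lemma ev_e0 (a : C) : ev (e 0) a = 1.
Proof. unfold ev. rewrite ip_e_l. unfold ker. simpl. unfold Cconj; simpl. rewrite Ropp_0. reflexivity. Qed.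

Lemma one_minus_neq0 (a b : C) : (Cmod a < 1)%R -> (Cmod b < 1)%R -> 1 - Cconj a * b <> 0.
Proof.
  intros Ha Hb H. assert (K : Cconj a * b = 1).
  { transitivity (1 - (1 - Cconj a * b)); [ring | rewrite H; ring]. }
  apply (f_equal Cmod) in K. rewrite Cmod_mult, Cmod_conj, Cmod_1 in K.
  pose proof (Cmod_ge_0 a). pose proof (Cmod_ge_0 b). nra.
Qed.

Lemma ev_ker (a b : C) : (Cmod a < 1)%R -> (Cmod b < 1)%R -> ev (ker b) a = 1 / (1 - Cconj b * a).
Proof.
  intros Ha Hb. assert (H : ev (ker b) a = 1 + Cconj b * a * ev (ker b) a).
  { rewrite (ker_fix b) at 1. unfold ev. rewrite ip_add_l, ip_sc_l by auto with l2.
    fold (ev (e 0) a) (ev (sh 1 (ker b)) a) (ev (ker b) a).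
    rewrite ev_e0, ev_sh1 by auto with l2. unfold ker at 1. simpl. ring. }
  assert (K : (1 - Cconj b * a) * ev (ker b) a = 1).
  { transitivity (ev (ker b) a - Cconj b * a * ev (ker b) a); [ring |]. rewrite H at 1. ring. }
  pose proof (one_minus_neq0 b a Hb Ha).
  transitivity ((1 - Cconj b * a) * ev (ker b) a / (1 - Cconj b * a)); [field; assumption | rewrite K; reflexivity].
Qed.

Lemma ev_sub (f g : Z -> C) (a : C) : (Cmod a < 1)%R -> L2 f -> L2 g -> ev (subF f g) a = ev f a - ev g a.
Proof. intros. apply ip_sub_l; auto with l2. Qed.

Lemma ev_sc (c : C) (f : Z -> C) (a : C) : (Cmod a < 1)%R -> L2 f -> ev (scF c f) a = c * ev f a.
Proof. intros. apply ip_sc_l; auto with l2. Qed.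

(* The Fourier coefficients of [(z - a) / (1 - conj a * z)]. *)
Definition bfac (a : C) : Z -> C := subF (sh 1 (ker a)) (scF a (ker a)).

(* [|z - a| = |1 - conj a * z|] on the circle. *)
Lemma ip_factor (a : C) (f g : Z -> C) : L2 f -> L2 g ->
  ip (subF (sh 1 f) (scF a f)) (subF (sh 1 g) (scF a g)) =
  ip (subF f (scF (Cconj a) (sh 1 f))) (subF g (scF (Cconj a) (sh 1 g))).
Proof.
  intros. rewrite !ip_sub_l, !ip_sub_r, !ip_sc_l, !ip_sc_r, !ip_sh, !Cconj_conj by auto with l2. ring.
Qed.

Lemma ker_inv (a : C) : subF (ker a) (scF (Cconj a) (sh 1 (ker a))) = e 0.
Proof.
  rewrite (ker_fix a) at 1. fext. unfold subF, addF. ring.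
Qed.

(** [ip_factor] trades the numerator z - a for 1 - conj(a) z, which the kernel inverts, so every
    inner product becomes a coefficient of [e 0]. *)
Lemma unimod_bfac (a : C) : (Cmod a < 1)%R -> unimod (bfac a).
Proof.
  intro H. unfold bfac. split; [auto with l2 |]. intro n.
  replace (sh n (subF (sh 1 (ker a)) (scF a (ker a))))
    with (subF (sh 1 (sh n (ker a))) (scF a (sh n (ker a)))).
  - rewrite ip_factor by auto with l2. rewrite ker_inv, ip_e_r.
    transitivity (sh n (subF (ker a) (scF (Cconj a) (sh 1 (ker a)))) 0%Z).
    + unfold sh, subF, scF. do 3 f_equal. lia.
    + rewrite ker_inv. unfold sh, e. zcases; reflexivity.
  - fext. unfold sh, subF, scF. do 2 f_equal. lia.
Qed.
#[local] Hint Resolve unimod_bfac : l2.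

(** The kernel is an affine function of the unimodular b = (z - a) k_a, because 1 + conj(a) b = (1 -
    |a|^2) k_a. *)
Lemma mult_ker (a : C) : (Cmod a < 1)%R -> multiplier (ker a).
Proof.
  intro H. assert (K : 1 - Cconj a * a <> 0) by (apply one_minus_neq0; assumption).
  assert (E : ker a = scF (/ (1 - Cconj a * a)) (addF (e 0) (scF (Cconj a) (bfac a)))).
  { rewrite <- (ker_inv a). fext. unfold scF, addF, bfac, subF, scF. field. exact K. }
  rewrite E. auto 8 with l2.
Qed.
#[local] Hint Resolve mult_ker : l2.

Lemma analytic_mulF (f g : Z -> C) : analytic f -> analytic g -> analytic (mulF f g).
Proof.
  intros Hf Hg n Hn. unfold mulF. rewrite <- sumZ_zero. f_equal. fext.
  destruct (Z_lt_le_dec n0 0); [rewrite Hf by assumption | rewrite Hg by lia]; ring.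
Qed.

Lemma analytic_ker (a : C) : analytic (ker a).
Proof. intros n Hn. unfold ker. zcases. reflexivity. Qed.

(** Kernels are eigenvectors of the Toeplitz operator with symbol conj(theta). The multiplicativity
    of [ev] on analytic functions rests on this. *)
Lemma star_mulF_ker (theta : Z -> C) (a : C) (n : Z) : (Cmod a < 1)%R -> L2 theta -> analytic theta ->
  (0 <= n)%Z -> mulF (star theta) (ker a) n = Cconj (ev theta a) * ker a n.
Proof.
  intros Ha Ht Hp Hn. rewrite mulF_ip. rewrite <- (Z.opp_involutive n) at 1.
  rewrite <- star_sh, ip_star, ip_conj by auto with l2.
  rewrite (ip_analytic_ext theta (sh (- n) (ker a)) (scF (ker a n) (ker a)) Hp).
  - rewrite ip_sc_r, Cmult_conj, Cconj_conj by auto with l2. unfold ev. ring.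
  - intros m Hm. unfold sh, scF. replace (m - - n)%Z with (m + Z.of_nat (Z.to_nat n))%Z by lia.
    rewrite ker_pow by assumption. unfold ker. zcases. ring.
Qed.

Lemma ev_mulF (theta h : Z -> C) (a : C) : (Cmod a < 1)%R -> multiplier theta -> analytic theta ->
  L2 h -> analytic h -> ev (mulF theta h) a = ev theta a * ev h a.
Proof.
  intros Ha Ht Hp Hh Hq. unfold ev at 1. rewrite mulF_adj by auto with l2.
  rewrite (ip_analytic_ext h _ (scF (Cconj (ev theta a)) (ker a)) Hq).
  - rewrite ip_sc_r, Cconj_conj by auto with l2. reflexivity.
  - intros n Hn. apply star_mulF_ker; auto with l2.
Qed.

Lemma analytic_bfac (a : C) : analytic (bfac a).
Proof.
  intros n Hn. unfold bfac, subF, sh, scF. rewrite !analytic_ker by lia. ring.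
Qed.

Lemma ev_bfac (a z : C) : (Cmod a < 1)%R -> (Cmod z < 1)%R -> ev (bfac a) z = (z - a) / (1 - Cconj a * z).
Proof.
  intros Ha Hz. unfold bfac. rewrite ev_sub, ev_sc, ev_sh1, ev_ker by auto with l2.
  rewrite (analytic_ker a) by lia. field. apply one_minus_neq0; assumption.
Qed.

(** Division by a single Blaschke factor. The coefficient at n < 0 is the pairing of h with z^n b_a,
    whose part at non-negative indices is a multiple of k_a. *)
Lemma analytic_star_bfac (a : C) (h : Z -> C) : (Cmod a < 1)%R -> L2 h -> analytic h ->
  ev h a = 0 -> analytic (mulF (star (bfac a)) h).
Proof.
  intros Ha Hh Hp H0 n Hn. rewrite <- ip_e_r, mulF_adj, star_star, mulF_e by auto with l2.
  rewrite (ip_analytic_ext h _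
     (* For k >= 1 the coefficient of b_a at k is conj(a)^(k-1) (1 - |a|^2); here k = m - n. *)
     (scF (Cpow (Cconj a) (Z.to_nat (- n - 1)) * (1 - a * Cconj a)) (ker a)) Hp).
  - rewrite ip_sc_r by auto with l2. fold (ev h a). rewrite H0. ring.
  - intros m Hm. unfold bfac, sh, subF, scF.
    replace (m - n - 1)%Z with (m + Z.of_nat (Z.to_nat (- n - 1)))%Z by lia.
    replace (m - n)%Z with (m + Z.of_nat (S (Z.to_nat (- n - 1))))%Z by lia.
    rewrite !ker_pow by assumption. simpl. ring.
Qed.

(** * Blaschke products *)

(** The unimodular constants [kappa] and [u] let one construction cover both normalisations: [kappa]
    is 1 for [Bn], and minus [bconst] for [bprod], whose factors have numerator a - z instead of z -
    a. *)
Fixpoint bp (a kappa : nat -> C) (sigma : nat -> bool) (u : C) (N : nat) : Z -> C :=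
  match N with
  | O => scF u (e 0)
  | S m => if sigma m then mulF (bp a kappa sigma u m) (scF (kappa m) (bfac (a m)))
           else bp a kappa sigma u m
  end.

Fixpoint bval (a kappa : nat -> C) (sigma : nat -> bool) (u : C) (N : nat) (z : C) : C :=
  match N with
  | O => u
  | S m => bval a kappa sigma u m z *
           (if sigma m then kappa m * ((z - a m) / (1 - Cconj (a m) * z)) else 1)
  end.

(* Together with analyticity, the last clause says that [theta] divides every function of [H^2]
   vanishing at the selected points. *)
Definition blaschke (a : nat -> C) (sigma : nat -> bool) (theta : Z -> C) : Prop :=
  unimod theta /\ analytic theta /\
  (forall j, sigma j = true -> ev theta (a j) = 0) /\
  (forall f, L2 f -> analytic f -> (forall j, sigma j = true -> ev f (a j) = 0) ->
     analytic (mulF (star theta) f)).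

Lemma analytic_sc (c : C) (f : Z -> C) : analytic f -> analytic (scF c f).
Proof. intros H n Hn. unfold scF. rewrite H by exact Hn. ring. Qed.

Lemma analytic_e0 : analytic (e 0).
Proof. intros n Hn. unfold e. zcases. reflexivity. Qed.

Lemma bp_unimod (a kappa : nat -> C) (sigma : nat -> bool) (u : C) (N : nat) :
  (forall j, (Cmod (a j) < 1)%R) -> (forall j, Cmod (kappa j) = 1%R) -> Cmod u = 1%R ->
  unimod (bp a kappa sigma u N).
Proof.
  intros Ha Hk Hu. induction N as [|N IH]; simpl.
  - apply unimod_sc, unimod_e. exact Hu.
  - destruct (sigma N); [| exact IH]. apply unimod_mulF; [exact IH |].
    apply unimod_sc; auto with l2.
Qed.

Lemma bp_analytic (a kappa : nat -> C) (sigma : nat -> bool) (u : C) (N : nat) :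
  analytic (bp a kappa sigma u N).
Proof.
  induction N as [|N IH]; simpl.
  - apply analytic_sc, analytic_e0.
  - destruct (sigma N); [| exact IH]. apply analytic_mulF, analytic_sc, analytic_bfac. exact IH.
Qed.

Lemma bp_ev (a kappa : nat -> C) (sigma : nat -> bool) (u : C) (N : nat) (z : C) :
  (forall j, (Cmod (a j) < 1)%R) -> (forall j, Cmod (kappa j) = 1%R) -> Cmod u = 1%R ->
  (Cmod z < 1)%R -> ev (bp a kappa sigma u N) z = bval a kappa sigma u N z.
Proof.
  intros Ha Hk Hu Hz. induction N as [|N IH]; simpl.
  - rewrite ev_sc, ev_e0 by auto with l2. ring.
  - destruct (sigma N); [| rewrite IH; ring].
    pose proof (bp_unimod a kappa sigma u N Ha Hk Hu).
    rewrite ev_mulF, ev_sc, ev_bfac, IH by auto using analytic_sc, analytic_bfac, bp_analytic with l2.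
    reflexivity.
Qed.

Lemma bval_zero (a kappa : nat -> C) (sigma : nat -> bool) (u : C) (N j : nat) :
  (j < N)%nat -> sigma j = true -> bval a kappa sigma u N (a j) = 0.
Proof.
  intros Hj Hs. induction N as [|N IH]; [lia |]. simpl. destruct (Nat.eq_dec j N) as [->|Hn].
  - rewrite Hs. replace (a N - a N) with (RtoC 0) by ring. unfold Cdiv. ring.
  - rewrite IH by lia. ring.
Qed.

Lemma bval_neq0 (a kappa : nat -> C) (sigma : nat -> bool) (u z : C) (N : nat) :
  (forall j, (Cmod (a j) < 1)%R) -> (forall j, Cmod (kappa j) = 1%R) -> Cmod u = 1%R ->
  (Cmod z < 1)%R -> (forall j, (j < N)%nat -> a j <> z) -> bval a kappa sigma u N z <> 0.
Proof.
  intros Ha Hk Hu Hz Hd. induction N as [|N IH]; simpl.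
  - intro K. rewrite K, Cmod_0 in Hu. lra.
  - apply Cmult_neq_0; [apply IH; intros; apply Hd; lia |].
    destruct (sigma N).
    + apply Cmult_neq_0; [intro K; specialize (Hk N); rewrite K, Cmod_0 in Hk; lra |].
      unfold Cdiv. apply Cmult_neq_0.
      * intro K. apply (Hd N); [lia |]. rewrite <- (Cplus_0_l (a N)), <- K. ring.
      * intro K. pose proof (one_minus_neq0 _ _ (Ha N) Hz) as Q.
        apply (f_equal (Cmult (1 - Cconj (a N) * z))) in K. rewrite Cinv_r in K by exact Q.
        rewrite Cmult_0_r in K. apply RtoC_inj in K. lra.
    + intro K. apply RtoC_inj in K. lra.
Qed.

(** Write f = B h with B the product so far. Since the zeros are distinct, B does not vanish at the
    next zero, so h does, and one more factor can be divided out. *)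
Lemma bp_divides (a kappa : nat -> C) (sigma : nat -> bool) (u : C) (N : nat) (f : Z -> C) :
  (forall j, (Cmod (a j) < 1)%R) -> (forall j, Cmod (kappa j) = 1%R) -> Cmod u = 1%R ->
  (forall i j, a i = a j -> i = j) -> L2 f -> analytic f ->
  (forall j, (j < N)%nat -> sigma j = true -> ev f (a j) = 0) ->
  analytic (mulF (star (bp a kappa sigma u N)) f).
Proof.
  intros Ha Hk Hu Hinj Hf Hp. induction N as [|N IH]; intro H0; simpl.
  - intros n Hn. replace (star (scF u (e 0))) with (scF (Cconj u) (e 0)).
    + rewrite mulF_sc_l, mulF_e_l, sh_0 by auto with l2. apply analytic_sc; assumption.
    + fext. unfold star, scF, e. rewrite Cmult_conj. f_equal.
      zcases; unfold Cconj; simpl; rewrite Ropp_0; reflexivity.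
  - assert (IH' : analytic (mulF (star (bp a kappa sigma u N)) f)) by (apply IH; intros; apply H0; auto with arith).
    destruct (sigma N) eqn:Hs; [| exact IH'].
    pose proof (bp_unimod a kappa sigma u N Ha Hk Hu) as HB.
    pose proof (bp_analytic a kappa sigma u N) as HBp.
    set (B := bp a kappa sigma u N) in *. set (h := mulF (star B) f) in *.
    assert (Hb : unimod (scF (kappa N) (bfac (a N)))) by (apply unimod_sc; auto with l2).
    assert (Hh : L2 h) by (unfold h; auto with l2).
    assert (E0 : ev h (a N) = 0).
    { assert (K : ev f (a N) = ev B (a N) * ev h (a N)).
      { rewrite <- ev_mulF by auto with l2. unfold h. rewrite unimod_inv' by auto with l2. reflexivity. }
      rewrite H0 in K by auto with arith. unfold B in K. rewrite bp_ev in K by auto.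
      symmetry in K. destruct (Ceq_dec (ev h (a N)) 0) as [E|E]; [exact E |].
      exfalso. revert K. apply Cmult_neq_0; [| exact E].
      apply bval_neq0; auto. intros j Hj K. apply Hinj in K. lia. }
    rewrite star_mulF, mulF_assoc, mulF_mulF_comm by auto with l2. fold h.
    replace (star (scF (kappa N) (bfac (a N)))) with (scF (Cconj (kappa N)) (star (bfac (a N)))).
    + rewrite mulF_sc_l by auto with l2. apply analytic_sc, analytic_star_bfac; auto.
    + fext. unfold star, scF. rewrite Cmult_conj. reflexivity.
Qed.

Lemma bp_blaschke (a kappa : nat -> C) (u : C) (N : nat) :
  (forall j, (Cmod (a j) < 1)%R) -> (forall j, Cmod (kappa j) = 1%R) -> Cmod u = 1%R ->
  (forall i j, a i = a j -> i = j) ->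
  blaschke a (fun j => Nat.ltb j N) (bp a kappa (fun _ => true) u N).
Proof.
  intros Ha Hk Hu Hinj. split; [apply bp_unimod; assumption |].
  split; [apply bp_analytic |]. split.
  - intros j Hj. apply Nat.ltb_lt in Hj. rewrite bp_ev by auto. apply bval_zero; auto.
  - intros f Hf Hp H0. apply bp_divides; auto. intros j Hj _. apply H0, Nat.ltb_lt, Hj.
Qed.

Lemma bp_split (a kappa : nat -> C) (sigma : nat -> bool) (u : C) (N k : nat) :
  (forall j, (Cmod (a j) < 1)%R) -> (forall j, Cmod (kappa j) = 1%R) -> Cmod u = 1%R ->
  bp a kappa sigma u (N + k) =
  mulF (bp a kappa sigma u N)
       (bp (fun j => a (N + j)%nat) (fun j => kappa (N + j)%nat) (fun j => sigma (N + j)%nat) 1 k).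
Proof.
  intros Ha Hk Hu. induction k as [|k IH].
  - rewrite Nat.add_0_r. cbn [bp]. pose proof (bp_unimod a kappa sigma u N Ha Hk Hu).
    rewrite mulF_sc_r, mulF_e, sh_0 by auto with l2. fext. unfold scF. ring.
  - rewrite Nat.add_succ_r. cbn [bp]. destruct (sigma (N + k)%nat); [| exact IH].
    rewrite IH.
    assert (H1 : unimod (bp a kappa sigma u N)) by (apply bp_unimod; assumption).
    assert (H2 : unimod (bp (fun j => a (N + j)%nat) (fun j => kappa (N + j)%nat)
      (fun j => sigma (N + j)%nat) 1 k)) by (apply bp_unimod; auto using Cmod_1).
    apply mulF_assoc; auto with l2.
Qed.

(** * Convergence of infinite Blaschke products *)

Fixpoint partial_defect (a : nat -> C) (N : nat) : R :=
  match N with O => 0%R | S m => (partial_defect a m + (1 - Cmod (a m)))%R end.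

(** The normalisation makes each factor at 0 equal to |a_j|, and the lower bound is the inequality
    that a product of numbers r_j in [0,1] is at least 1 minus the sum of the 1 - r_j. *)
Lemma bval_at_0 (a kappa : nat -> C) (sigma : nat -> bool) (k : nat) :
  (forall j, (Cmod (a j) < 1)%R) ->
  (forall j, sigma j = true -> kappa j * (- a j) = RtoC (Cmod (a j))) ->
  exists r, bval a kappa sigma 1 k 0 = RtoC r /\ (0 <= r <= 1)%R /\ (1 - partial_defect a k <= r)%R.
Proof.
  intros Ha Hk. induction k as [|k [r [E [H1 H2]]]]; simpl.
  - exists 1%R. split; [reflexivity | lra].
  - pose proof (Ha k). pose proof (Cmod_ge_0 (a k)). destruct (sigma k) eqn:Hs.
    + exists (r * Cmod (a k))%R. split; [| nra].
      rewrite E, RtoC_mult, <- (Hk k Hs).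
      replace (1 - Cconj (a k) * 0) with (RtoC 1) by ring. field.
    + exists r. split; [rewrite E; ring | lra].
Qed.

Lemma partial_defect_shift (a : nat -> C) (N k : nat) :
  partial_defect (fun j => a (N + j)%nat) k = (partial_defect a (N + k) - partial_defect a N)%R.
Proof.
  induction k as [|k IH].
  - rewrite Nat.add_0_r. simpl. ring.
  - rewrite Nat.add_succ_r. simpl. rewrite IH. ring.
Qed.

Lemma norm2_unimod (theta : Z -> C) : unimod theta -> norm2 theta = 1%R.
Proof.
  intro H. apply RtoC_inj. rewrite <- ip_norm2, <- (sh_0 theta), unimod_sh by exact H. reflexivity.
Qed.

Lemma ev_0 (f : Z -> C) : ev f 0 = f 0%Z.
Proof.
  unfold ev. rewrite <- (ip_e_r f 0). f_equal. rewrite ker_fix.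
  replace (Cconj 0) with (RtoC 0) by (unfold Cconj; simpl; rewrite Ropp_0; reflexivity).
  fext. unfold addF, scF. ring.
Qed.

(* [||B_(N+k) - B_N||^2 = 2 - 2 Re (B_(N+k) / B_N) (0)], and the quotient at [0] is a product of [|a_j|]. *)
Lemma bp_cauchy (a kappa : nat -> C) (sigma : nat -> bool) (u : C) (N k : nat) :
  (forall j, (Cmod (a j) < 1)%R) -> (forall j, Cmod (kappa j) = 1%R) -> Cmod u = 1%R ->
  (forall j, sigma j = true -> kappa j * (- a j) = RtoC (Cmod (a j))) ->
  (norm2 (subF (bp a kappa sigma u (N + k)) (bp a kappa sigma u N)) <=
   2 * (partial_defect a (N + k) - partial_defect a N))%R.
Proof.
  intros Ha Hk Hu Hn.
  pose proof (bp_unimod a kappa sigma u N Ha Hk Hu) as H1.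
  pose proof (bp_unimod a kappa sigma u (N + k) Ha Hk Hu) as H2.
  rewrite norm2_sub, !norm2_unimod, bp_split by auto with l2.
  set (B := bp a kappa sigma u N) in *.
  assert (HT : unimod (bp (fun j => a (N + j)%nat) (fun j => kappa (N + j)%nat)
    (fun j => sigma (N + j)%nat) 1 k)) by (apply bp_unimod; auto using Cmod_1).
  replace B with (mulF B (e 0)) at 2 by (rewrite mulF_e, sh_0 by auto with l2; reflexivity).
  rewrite unimod_isom, ip_e_r by auto with l2.
  rewrite <- ev_0, bp_ev by (auto; rewrite ?Cmod_1, ?Cmod_0; lra).
  destruct (bval_at_0 (fun j => a (N + j)%nat) (fun j => kappa (N + j)%nat)
    (fun j => sigma (N + j)%nat) k) as [r [E [_ Hr]]]; [auto .. |].
  rewrite E, <- partial_defect_shift. unfold Re; simpl. lra.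
Qed.

Lemma partial_defect_incr (a : nat -> C) (N k : nat) : (forall j, (Cmod (a j) < 1)%R) ->
  (partial_defect a N <= partial_defect a (N + k))%R.
Proof.
  intro Ha. induction k as [|k IH].
  - rewrite Nat.add_0_r. lra.
  - rewrite Nat.add_succ_r. simpl. specialize (Ha (N + k)%nat). lra.
Qed.

Lemma partial_defect_lim (a : nat -> C) : (forall j, (Cmod (a j) < 1)%R) ->
  ex_series (fun j => (1 - Cmod (a j))%R) ->
  exists l : R, is_lim_seq (partial_defect a) l /\ forall N, (partial_defect a N <= l)%R.
Proof.
  intros Ha [l Hl]. exists l.
  assert (H : is_lim_seq (partial_defect a) l).
  { apply is_lim_seq_incr_1. eapply is_lim_seq_ext; [| exact Hl]. intro n.
    change (sum_n (fun j => (1 - Cmod (a j))%R) n = partial_defect a (S n)).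
    induction n as [|n IH].
    - rewrite sum_O. simpl. ring.
    - rewrite sum_Sn, IH. reflexivity. }
  split; [exact H |]. apply is_lim_seq_incr_compare; [exact H |].
  intro n. pose proof (partial_defect_incr a n 1 Ha) as K. rewrite Nat.add_1_r in K. exact K.
Qed.

Lemma cvC_ev (F : nat -> Z -> C) (f : Z -> C) (v : nat -> R) (z : C) : (Cmod z < 1)%R ->
  (forall N, L2 (F N)) -> L2 f -> (forall N, (norm2 (subF f (F N)) <= v N)%R) ->
  is_lim_seq v 0%R -> cvC (fun N => ev (F N) z) (ev f z).
Proof.
  intros Hz HF Hf Hv Hl. apply cvC_bound with (fun N => norm2 (ker z) * v N)%R.
  - intro N. replace (ev (F N) z - ev f z) with (- ev (subF f (F N)) z)
      by (rewrite ev_sub by auto with l2; ring).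
    rewrite Cmod_opp. eapply Rle_trans; [apply Cauchy_Schwarz; auto with l2 |].
    pose proof (norm2_ge0 (ker z) (L2_ker z Hz)). specialize (Hv N). nra.
  - pose proof (is_lim_seq_scal_l _ (norm2 (ker z)) _ Hl) as K. simpl in K.
    rewrite Rmult_0_r in K. exact K.
Qed.

Lemma bp_limit (a kappa : nat -> C) (sigma : nat -> bool) (u : C) :
  (forall j, (Cmod (a j) < 1)%R) -> (forall j, Cmod (kappa j) = 1%R) -> Cmod u = 1%R ->
  (forall j, sigma j = true -> kappa j * (- a j) = RtoC (Cmod (a j))) ->
  (forall i j, a i = a j -> i = j) ->
  ex_series (fun j => (1 - Cmod (a j))%R) ->
  exists theta, blaschke a sigma theta /\
    forall z, (Cmod z < 1)%R -> cvC (fun N => bval a kappa sigma u N z) (ev theta z).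
Proof.
  intros Ha Hk Hu Hn Hinj Hs. destruct (partial_defect_lim a Ha Hs) as [l [Hl Hle]].
  set (v := fun N => (2 * (l - partial_defect a N))%R).
  assert (Hv : is_lim_seq v 0%R).
  { replace 0%R with (2 * (l - l))%R by ring. unfold v.
    apply (is_lim_seq_scal_l _ 2%R (l - l)%R), is_lim_seq_minus'; [apply is_lim_seq_const | exact Hl]. }
  assert (HB : forall N, unimod (bp a kappa sigma u N)) by (intro; apply bp_unimod; assumption).
  destruct (L2_complete (bp a kappa sigma u) v) as [theta [Ht Hd]].
  - auto with l2.
  - intros N k. eapply Rle_trans; [apply bp_cauchy; assumption |]. unfold v.
    specialize (Hle (N + k)%nat). lra.
  - exact Hv.
  - assert (HU : unimod theta) by (apply (unimod_limit (bp a kappa sigma u) theta v); assumption).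
    (* Each property of the limit is the vanishing of some number [w] that is already 0 for long
       partial products, so [w] is bounded by the distance to them. *)
    assert (Hzero : forall w c n, (0 <= c)%R -> (forall N, (Cmod (0 - w) ^ 2 <= c * v (N + n)%nat)%R) -> w = 0).
    { intros w c n Hc Hw. apply (cvC_unique (fun _ => 0)); [| apply cvC_const].
      apply cvC_bound with (fun N => c * v (N + n)%nat)%R; [exact Hw |].
      apply (is_lim_seq_incr_n v n) in Hv. pose proof (is_lim_seq_scal_l _ c _ Hv) as K. simpl in K.
      rewrite Rmult_0_r in K. exact K. }
    exists theta. split; [split; [exact HU |]; split; [| split] |].
    + intros n Hneg. apply (Hzero _ 1%R 0%nat); [lra |]. intro N.
      rewrite Nat.add_0_r, Rmult_1_l. eapply Rle_trans; [| apply Hd].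
      replace (0 - theta n) with (- subF theta (bp a kappa sigma u N) n).
      * rewrite Cmod_opp. apply norm2_coef. auto with l2.
      * unfold subF. rewrite bp_analytic by exact Hneg. ring.
    (* The offset [S j] ensures that the factor with zero [a j] is in the partial product. *)
    + intros j Hj. apply (Hzero _ (norm2 (ker (a j))) (S j)); [apply norm2_ge0; auto with l2 |]. intro N.
      replace (0 - ev theta (a j)) with (- ev (subF theta (bp a kappa sigma u (N + S j))) (a j)).
      * rewrite Cmod_opp. eapply Rle_trans; [apply Cauchy_Schwarz; auto with l2 |].
        rewrite Rmult_comm. apply Rmult_le_compat_l; [apply norm2_ge0; auto with l2 | apply Hd].
      * rewrite ev_sub, bp_ev, bval_zero by (auto with l2; lia). ring.
    + intros f Hf Hp H0 n Hneg. apply (Hzero _ (norm2 f) 0%nat); [apply norm2_ge0, Hf |]. intro N.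
      rewrite Nat.add_0_r.
      replace (0 - mulF (star theta) f n) with (- mulF (star (subF theta (bp a kappa sigma u N))) f n).
      * rewrite Cmod_opp. eapply Rle_trans; [apply mulF_bound; auto with l2 |].
        rewrite norm2_star, Rmult_comm by auto with l2.
        apply Rmult_le_compat_l; [apply norm2_ge0, Hf | apply Hd].
      * replace (star (subF theta (bp a kappa sigma u N)))
          with (subF (star theta) (star (bp a kappa sigma u N)))
          by (fext; unfold star, subF; rewrite Cminus_conj; reflexivity).
        rewrite mulF_sub_l by auto with l2. unfold subF.
        rewrite (bp_divides a kappa sigma u N f) by auto. ring.
    + intros z Hz. destruct (cvC_ev (bp a kappa sigma u) theta v z) as [K1 K2]; [auto with l2 .. |].
      split; [eapply is_lim_seq_ext; [| exact K1] | eapply is_lim_seq_ext; [| exact K2]];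
      intro N; cbv beta; rewrite bp_ev by auto; reflexivity.
Qed.

(** * Taylor coefficients *)

Lemma cvC_filterlim (u : nat -> C) (w : C) : filterlim u eventually (locally w) <-> cvC u w.
Proof.
  split.
  - intro H. split; (eapply filterlim_comp; [exact H |]); [apply continuous_fst | apply continuous_snd].
  - intros [H K]. apply filterlim_locally. intro eps.
    pose proof (proj1 (filterlim_locally _ _) H eps) as A.
    pose proof (proj1 (filterlim_locally _ _) K eps) as B.
    generalize (filter_and _ _ A B). apply filter_imp. intros x [X Y]. split; [exact X | exact Y].
Qed.

Lemma sum_n_fst (u : nat -> C) (N : nat) : fst (sum_n u N) = sum_n (fun k => Re (u k)) N.
Proof.
  induction N as [|N IH]; [rewrite !sum_O; reflexivity |].
  rewrite !sum_Sn. change (fst (sum_n u N + u (S N)) = (sum_n (fun k => Re (u k)) N + Re (u (S N)))%R).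
  rewrite <- IH. reflexivity.
Qed.

Lemma sum_n_snd (u : nat -> C) (N : nat) : snd (sum_n u N) = sum_n (fun k => Im (u k)) N.
Proof.
  induction N as [|N IH]; [rewrite !sum_O; reflexivity |].
  rewrite !sum_Sn. change (snd (sum_n u N + u (S N)) = (sum_n (fun k => Im (u k)) N + Im (u (S N)))%R).
  rewrite <- IH. reflexivity.
Qed.

Lemma is_series_C (u : nat -> C) (w : C) :
  is_series u w <-> is_series (fun k => Re (u k)) (Re w) /\ is_series (fun k => Im (u k)) (Im w).
Proof.
  split.
  - intro H. apply (cvC_filterlim (sum_n u) w) in H. destruct H as [H1 H2]. split.
    + change (is_lim_seq (sum_n (fun k => Re (u k))) (Re w)).
      eapply is_lim_seq_ext; [| exact H1]. intro n. apply sum_n_fst.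
    + change (is_lim_seq (sum_n (fun k => Im (u k))) (Im w)).
      eapply is_lim_seq_ext; [| exact H2]. intro n. apply sum_n_snd.
  - intros [H1 H2]. apply (cvC_filterlim (sum_n u) w). split.
    + eapply is_lim_seq_ext; [| exact H1]. intro n. symmetry. apply sum_n_fst.
    + eapply is_lim_seq_ext; [| exact H2]. intro n. symmetry. apply sum_n_snd.
Qed.

Lemma ev_series (f : Z -> C) (z : C) : (Cmod z < 1)%R -> L2 f -> analytic f ->
  is_series (fun k => f (Z.of_nat k) * pow_n z k) (ev f z).
Proof.
  intros Hz Hf Hp.
  assert (Hpow : forall k, pow_n z k = Cconj (ker z (Z.of_nat k))).
  { intro k. unfold ker. zcases. rewrite Nat2Z.id, Cpow_conj, Cconj_conj.
    induction k as [|k IH]; [reflexivity |]. simpl. rewrite IH by lia. reflexivity. }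
  assert (Hneg : forall k, f (- Z.of_nat (S k))%Z = 0) by (intro; apply Hp; lia).
  destruct (SC_ip f (ker z) Hf (L2_ker z Hz)) as [[H1 _] [H2 _]].
  apply ex_series_Rabs in H1. apply ex_series_Rabs in H2.
  assert (E : forall p : C -> R, (forall x, p (0 * x) = 0%R) ->
    ex_series (fun n => p (f (Z.of_nat n) * Cconj (ker z (Z.of_nat n)))) ->
    is_series (fun k => p (f (Z.of_nat k) * pow_n z k)) (sumR (fun n => p (f n * Cconj (ker z n))))).
  { intros p Hp0 He. unfold sumR.
    rewrite (Series_ext (fun n => p (f (- Z.of_nat (S n))%Z * Cconj (ker z (- Z.of_nat (S n))%Z)))
      (fun _ => 0%R)) by (intro; rewrite Hneg; apply Hp0).
    rewrite (is_series_unique (fun _ => 0%R) 0%R) by (apply (is_series_head (fun _ => 0%R)); reflexivity).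
    rewrite Rplus_0_r. eapply is_series_ext; [| apply Series_correct, He].
    intro k. cbv beta. rewrite Hpow. reflexivity. }
  apply is_series_C. split.
  - apply (E Re); [intro x; unfold Re; simpl; ring | exact H1].
  - apply (E Im); [intro x; unfold Im; simpl; ring | exact H2].
Qed.

Lemma CV_radius_pos (a : nat -> R) :
  ex_series (fun k => (a k * (1 / 2) ^ k)%R) -> Rbar_lt 0 (CV_radius a).
Proof.
  intro H. destruct (Rbar_lt_le_dec 0 (CV_radius a)) as [K|K]; [exact K | exfalso].
  apply (CV_disk_outside a (1 / 2)).
  - eapply Rbar_le_lt_trans; [exact K |]. simpl. rewrite Rabs_pos_eq; lra.
  - apply ex_series_lim_0, H.
Qed.

Lemma PSeries_coef_unique (a b : nat -> R) :
  (forall x : R, (Rabs x < 1)%R -> exists l,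
     is_series (fun k => (a k * x ^ k)%R) l /\ is_series (fun k => (b k * x ^ k)%R) l) ->
  forall n, a n = b n.
Proof.
  intros H n.
  assert (Hh : (Rabs (1 / 2) < 1)%R) by (rewrite Rabs_pos_eq; lra).
  destruct (H _ Hh) as [l [H1 H2]].
  apply PSeries_ext_recip.
  - apply CV_radius_pos. exists l. exact H1.
  - apply CV_radius_pos. exists l. exact H2.
  - exists (mkposreal 1 Rlt_0_1). intros x Hx.
    assert (Hx' : (Rabs x < 1)%R).
    { change (Rabs (x - 0) < 1)%R in Hx. rewrite Rminus_0_r in Hx. exact Hx. }
    destruct (H x Hx') as [m [K1 K2]].
    unfold PSeries. rewrite (is_series_unique _ _ K1), (is_series_unique _ _ K2). reflexivity.
Qed.

(** The identity theorem on the real diameter: there the powers of x are real, so the real and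
    imaginary parts of the coefficients form separate real power series. *)
Lemma taylor_extZ (G : nat -> C -> C) (c : nat -> C) (theta : Z -> C) :
  taylor_of G c -> L2 theta -> analytic theta ->
  (forall z, (Cmod z < 1)%R -> cvC (fun N => G N z) (ev theta z)) -> extZ c = theta.
Proof.
  intros HG Ht Hp Hc.
  assert (H : forall x : R, (Rabs x < 1)%R ->
    exists w, is_series (fun k => c k * RtoC (x ^ k)) w /\
              is_series (fun k => theta (Z.of_nat k) * RtoC (x ^ k)) w).
  { intros x Hx. assert (Hz : (Cmod (RtoC x) < 1)%R) by (rewrite Cmod_R; exact Hx).
    assert (Hpow : forall k, pow_n (RtoC x) k = RtoC (x ^ k)).
    { induction k as [|k IH]; [reflexivity |]. simpl. rewrite IH, RtoC_mult. reflexivity. }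
    destruct (HG _ Hz) as [w [H1 H2]]. apply (cvC_filterlim (fun N => G N x)) in H2.
    pose proof (cvC_unique _ _ _ H2 (Hc _ Hz)) as E. subst w.
    exists (ev theta x). split.
    - eapply is_series_ext; [| exact H1]. intro k. cbv beta. rewrite Hpow. reflexivity.
    - eapply is_series_ext; [| exact (ev_series theta x Hz Ht Hp)]. intro k. cbv beta. rewrite Hpow. reflexivity. }
  assert (E : forall k, c k = theta (Z.of_nat k)).
  { intro k. apply injective_projections.
    - apply (PSeries_coef_unique (fun k => Re (c k)) (fun k => Re (theta (Z.of_nat k)))).
      intros x Hx. destruct (H x Hx) as [w [H1 H2]].
      apply is_series_C in H1. apply is_series_C in H2. exists (Re w).
      split; [eapply is_series_ext; [| apply H1] | eapply is_series_ext; [| apply H2]];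
      intro j; unfold Re; simpl; ring.
    - apply (PSeries_coef_unique (fun k => Im (c k)) (fun k => Im (theta (Z.of_nat k)))).
      intros x Hx. destruct (H x Hx) as [w [H1 H2]].
      apply is_series_C in H1. apply is_series_C in H2. exists (Im w).
      split; [eapply is_series_ext; [| apply H1] | eapply is_series_ext; [| apply H2]];
      intro j; unfold Im; simpl; ring. }
  fext. destruct n as [|p|p]; simpl.
  - apply E.
  - rewrite E. f_equal. apply positive_nat_Z.
  - symmetry. apply Hp. lia.
Qed.

(** Conditions (2) and (3) quantify over Taylor sequences, so using them as hypotheses requires
    producing such a sequence. *)
Lemma taylor_intro (G : nat -> C -> C) (theta : Z -> C) : L2 theta -> analytic theta ->
  (forall z, (Cmod z < 1)%R -> cvC (fun N => G N z) (ev theta z)) ->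
  taylor_of G (fun k => theta (Z.of_nat k)) /\ extZ (fun k => theta (Z.of_nat k)) = theta.
Proof.
  intros Ht Hp Hc.
  assert (H : taylor_of G (fun k => theta (Z.of_nat k))).
  { intros z Hz. exists (ev theta z). split; [apply ev_series; assumption |].
    apply cvC_filterlim, Hc, Hz. }
  split; [exact H | apply (taylor_extZ G); assumption].
Qed.

(** * The concrete products [bprod] and [Bn] *)

Lemma Cmod_bconst (a : C) : Cmod (bconst a) = 1%R.
Proof.
  unfold bconst. destruct (Req_EM_T (Cmod a) 0) as [H|H].
  - rewrite Cmod_R, Rabs_left; lra.
  - pose proof (Cmod_ge_0 a). rewrite Cmod_div by (intro K; apply RtoC_inj in K; contradiction).
    rewrite Cmod_conj, Cmod_R, Rabs_pos_eq by lra. field. exact H.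
Qed.

Lemma bconst_mult (a : C) : bconst a * a = RtoC (Cmod a).
Proof.
  unfold bconst. destruct (Req_EM_T (Cmod a) 0) as [H|H].
  - rewrite (Cmod_eq_0 a H), Cmod_0. ring.
  - assert (K : RtoC (Cmod a) <> 0) by (intro K; apply RtoC_inj in K; contradiction).
    replace (Cconj a / Cmod a * a) with (Cconj a * a / Cmod a) by (field; exact K).
    rewrite Cmod2_conj_l, <- RtoC_div by assumption. f_equal. field. exact H.
Qed.

Lemma Cmod_cos_sin (g : R) : Cmod (cos g, sin g) = 1%R.
Proof.
  unfold Cmod. simpl. transitivity (sqrt 1); [| apply sqrt_1]. f_equal.
  pose proof (sin2_cos2 g) as H. unfold Rsqr in H. lra.
Qed.

Lemma bprod_bval (a : nat -> C) (sigma : nat -> bool) (g : R) (N : nat) (z : C) :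
  bprod a sigma g N z = bval a (fun j => - bconst (a j)) sigma (cos g, sin g) N z.
Proof.
  unfold bprod. induction N as [|N IH]; simpl.
  - ring.
  - rewrite <- IH. destruct (sigma N); [| ring]. unfold bfactor, Cdiv. ring.
Qed.

Lemma Bn_bval (a : nat -> C) (N : nat) (z : C) :
  Bn a N z = bval a (fun _ => 1) (fun _ => true) 1 N z.
Proof. induction N as [|N IH]; simpl; [reflexivity | rewrite IH; ring]. Qed.

Lemma bprod_limit (a : nat -> C) (sigma : nat -> bool) (g : R) :
  (forall j, (Cmod (a j) < 1)%R) -> (forall i j, a i = a j -> i = j) ->
  ex_series (fun j => (1 - Cmod (a j))%R) ->
  exists theta, blaschke a sigma theta /\
    forall z, (Cmod z < 1)%R -> cvC (fun N => bprod a sigma g N z) (ev theta z).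
Proof.
  intros Ha Hinj Hs.
  destruct (bp_limit a (fun j => - bconst (a j)) sigma (cos g, sin g)) as [theta [Hb Hv]]; auto.
  - intro j. rewrite Cmod_opp. apply Cmod_bconst.
  - apply Cmod_cos_sin.
  - intros j _. rewrite <- bconst_mult. ring.
  - exists theta. split; [exact Hb |]. intros z Hz. destruct (Hv z Hz) as [H1 H2].
    split; [eapply is_lim_seq_ext; [| exact H1] | eapply is_lim_seq_ext; [| exact H2]];
    intro N; cbv beta; rewrite bprod_bval; reflexivity.
Qed.

Lemma bprod_blaschke (a : nat -> C) (sigma : nat -> bool) (g : R) (c : nat -> C) :
  (forall j, (Cmod (a j) < 1)%R) -> (forall i j, a i = a j -> i = j) ->
  ex_series (fun j => (1 - Cmod (a j))%R) ->
  taylor_of (bprod a sigma g) c -> blaschke a sigma (extZ c).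
Proof.
  intros Ha Hinj Hs Ht. destruct (bprod_limit a sigma g Ha Hinj Hs) as [theta [Hb Hv]].
  rewrite (taylor_extZ (bprod a sigma g) c theta); [exact Hb | exact Ht | apply Hb | apply Hb | exact Hv].
Qed.

Definition Bcoef (a : nat -> C) (n : nat) : Z -> C := bp a (fun _ => 1) (fun _ => true) 1 n.

Lemma Bn_blaschke (a : nat -> C) (n : nat) :
  (forall j, (Cmod (a j) < 1)%R) -> (forall i j, a i = a j -> i = j) ->
  blaschke a (fun j => Nat.ltb j n) (Bcoef a n).
Proof. intros. apply bp_blaschke; auto using Cmod_1. Qed.

Lemma cvC_Bn (a : nat -> C) (n : nat) (z : C) : (forall j, (Cmod (a j) < 1)%R) -> (Cmod z < 1)%R ->
  cvC (fun _ => Bn a n z) (ev (Bcoef a n) z).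
Proof.
  intros Ha Hz. unfold Bcoef. rewrite bp_ev, <- Bn_bval by auto using Cmod_1. apply cvC_const.
Qed.

(** A repeated zero contributes a factor 0, so the partial products for i vanish from [S j] on and
    their limit is below [delta]. *)
Lemma separated_inj (a : nat -> C) (delta : R) : (0 < delta)%R ->
  (forall n, Rbar_le (Finite delta) (Lim_seq (sep_partial a n))) ->
  forall i j, a i = a j -> i = j.
Proof.
  intros Hd Hs i j E. destruct (Nat.eq_dec i j) as [H|H]; [exact H | exfalso].
  assert (Z0 : forall k, sep_partial a i (k + S j) = 0%R).
  { induction k as [|k IH]; simpl.
    - destruct (Nat.eq_dec j i); [congruence |].
      replace (a j - a i) with (RtoC 0) by (rewrite E; ring). unfold Cdiv.
      rewrite Cmult_0_l, Cmod_0. ring.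
    - rewrite IH. ring. }
  assert (L : is_lim_seq (sep_partial a i) 0%R).
  { apply (is_lim_seq_incr_n _ (S j)). eapply is_lim_seq_ext; [intro k; symmetry; apply Z0 |].
    apply is_lim_seq_const. }
  specialize (Hs i). rewrite (is_lim_seq_unique _ _ L) in Hs. simpl in Hs. lra.
Qed.

(** * Model spaces and conjugations *)

Definition pos (f : Z -> C) : Z -> C := fun n => if Z.leb 0 n then f n else 0.

(** The formula P_theta = P_+ - theta P_+ conj(theta) P_+, with [pos] as the Riesz projection P_+;
    it provides the orthogonal projection explicitly. *)
Definition proj (theta f : Z -> C) : Z -> C :=
  subF (pos f) (mulF theta (pos (mulF (star theta) (pos f)))).

Lemma L2_pos (f : Z -> C) : L2 f -> L2 (pos f).
Proof.
  rewrite !L2_SR. apply SR_le. intro n. rewrite Rabs_pos_eq by apply Cmod2_ge0.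
  unfold pos. zcases; [lra |]. rewrite Cmod_0. pose proof (Cmod2_ge0 (f n)). lra.
Qed.
#[local] Hint Resolve L2_pos : l2.

Lemma analytic_pos (f : Z -> C) : analytic (pos f).
Proof. intros n Hn. unfold pos. zcases. reflexivity. Qed.

Lemma ip_pos (f h : Z -> C) : analytic h -> ip (pos f) h = ip f h.
Proof.
  intro H. rewrite (ip_conj h), (ip_conj h f). f_equal. apply ip_analytic_ext; [exact H |].
  intros n Hn. unfold pos. zcases. reflexivity.
Qed.

Lemma Kmodel_L2 (theta f : Z -> C) : Kmodel theta f -> L2 f.
Proof. intros [[H _] _]. exact H. Qed.
#[local] Hint Resolve Kmodel_L2 : l2.

Lemma Kmodel_analytic (theta f : Z -> C) : Kmodel theta f -> analytic f.
Proof. intros [[_ H] _]. exact H. Qed.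

Lemma Kmodel_add (theta f g : Z -> C) : unimod theta ->
  Kmodel theta f -> Kmodel theta g -> Kmodel theta (addF f g).
Proof.
  intros Ht [[F1 F2] F3] [[G1 G2] G3]. split; [split |].
  - auto 12 with l2.
  - intros n Hn. unfold addF. rewrite F2, G2 by exact Hn. ring.
  - intros h Hh. pose proof (proj1 Hh). rewrite ip_add_l, F3, G3 by auto 12 with l2. ring.
Qed.

Lemma Kmodel_sc (theta f : Z -> C) (c : C) : unimod theta -> Kmodel theta f -> Kmodel theta (scF c f).
Proof.
  intros Ht [[F1 F2] F3]. split; [split |].
  - auto 12 with l2.
  - intros n Hn. unfold scF. rewrite F2 by exact Hn. ring.
  - intros h Hh. pose proof (proj1 Hh). rewrite ip_sc_l, F3 by auto 12 with l2. ring.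
Qed.

Lemma Kmodel_sub (theta f g : Z -> C) : unimod theta ->
  Kmodel theta f -> Kmodel theta g -> Kmodel theta (subF f g).
Proof. intros. rewrite subF_eq. auto using Kmodel_add, Kmodel_sc. Qed.

Lemma Kmodel_ext (theta f g : Z -> C) : unimod theta -> Kmodel theta f -> Kmodel theta g ->
  (forall k, Kmodel theta k -> ip f k = ip g k) -> f = g.
Proof.
  intros Ht Hf Hg H.
  assert (E : subF f g = zeroF).
  { apply norm2_eq0; [eauto 12 with l2 |].
    assert (N : RtoC (norm2 (subF f g)) = 0).
    { rewrite <- ip_norm2. rewrite ip_sub_l by eauto 12 with l2.
      rewrite H by (apply Kmodel_sub; assumption). ring. }
    apply RtoC_inj in N. lra. }
  fext. apply (f_equal (fun u => u n + g n)) in E. unfold subF, zeroF in E.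
  transitivity (f n - g n + g n); [ring | rewrite E; ring].
Qed.

Lemma proj_in (theta f : Z -> C) : unimod theta -> analytic theta -> L2 f -> Kmodel theta (proj theta f).
Proof.
  intros Ht Hp Hf. unfold proj. split; [split |].
  - auto 12 with l2.
  - intros n Hn. unfold subF. rewrite analytic_pos by exact Hn.
    rewrite (analytic_mulF theta _ Hp (analytic_pos _)) by exact Hn. ring.
  - intros h [Hh Hh']. rewrite ip_sub_l, unimod_isom by auto 12 with l2.
    rewrite (ip_pos (mulF (star theta) (pos f))) by exact Hh'.
    rewrite mulF_adj, star_star by auto 12 with l2. ring.
Qed.

Lemma proj_ip (theta f k : Z -> C) : unimod theta -> analytic theta -> L2 f -> Kmodel theta k ->
  ip (proj theta f) k = ip f k.
Proof.
  intros Ht Hp Hf Hk. pose proof Hk as [[K1 K2] K3]. unfold proj.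
  rewrite ip_sub_l, ip_pos by auto 12 with l2.
  rewrite (ip_conj k (mulF theta _)), K3.
  - unfold Cconj; apply injective_projections; simpl; ring.
  - split; [auto 12 with l2 | apply analytic_pos].
Qed.

Lemma proj_eq (theta f p : Z -> C) : unimod theta -> analytic theta -> L2 f -> Kmodel theta p ->
  (forall k, Kmodel theta k -> ip p k = ip f k) -> proj theta f = p.
Proof.
  intros Ht Hp Hf HK H. apply (Kmodel_ext theta); auto using proj_in.
  intros k Hk. rewrite proj_ip, H; auto.
Qed.

Lemma is_proj_ip (theta g p k : Z -> C) : L2 g -> is_proj (Kmodel theta) g p -> Kmodel theta k ->
  ip p k = ip g k.
Proof.
  intros Hg [H1 H2] Hk. specialize (H2 k Hk). change (ip (subF g p) k = 0) in H2.
  rewrite ip_sub_l in H2 by eauto 12 with l2.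
  transitivity (ip g k - (ip g k - ip p k)); [ring | rewrite H2; ring].
Qed.

Lemma is_proj_proj (theta g : Z -> C) : unimod theta -> analytic theta -> L2 g ->
  is_proj (Kmodel theta) g (proj theta g).
Proof.
  intros Ht Hp Hg. split; [apply proj_in; assumption |]. intros k Hk.
  change (ip (subF g (proj theta g)) k = 0). 
  assert (L2 (proj theta g)) by (eapply Kmodel_L2, proj_in; assumption).
  rewrite ip_sub_l, proj_ip by eauto 12 with l2. ring.
Qed.

Lemma norm2_proj (theta f : Z -> C) : unimod theta -> analytic theta -> L2 f ->
  (norm2 (proj theta f) <= norm2 f)%R.
Proof.
  intros Ht Hp Hf. pose proof (proj_in theta f Ht Hp Hf) as HK.
  pose proof (Kmodel_L2 _ _ HK) as HL. pose proof (Cauchy_Schwarz _ _ Hf HL) as H.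
  rewrite <- (proj_ip theta f _ Ht Hp Hf HK), ip_norm2, Cmod_R, Rabs_pos_eq in H
    by (apply norm2_ge0, HL).
  pose proof (norm2_ge0 _ HL). pose proof (norm2_ge0 _ Hf). nra.
Qed.

(** * The conjugation of a model space *)

Lemma Cop_eq (theta f : Z -> C) : Cop theta f = mulF theta (sh (-1) (star f)).
Proof.
  unfold Cop. f_equal. fext. unfold sh, star. do 2 f_equal. lia.
Qed.

Lemma L2_Cop (theta f : Z -> C) : unimod theta -> L2 f -> L2 (Cop theta f).
Proof. intros. rewrite Cop_eq. auto 12 with l2. Qed.
#[local] Hint Resolve L2_Cop : l2.

(** Both sides are the integral of theta conj(z f g). *)
Lemma ip_Cop (theta f g : Z -> C) : unimod theta -> L2 f -> L2 g ->
  ip (Cop theta f) g = ip (Cop theta g) f.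
Proof.
  intros Ht Hf Hg. rewrite !Cop_eq, mulF_adj, ip_sh_l by auto 12 with l2.
  rewrite <- (star_star (sh (- -1) _)), ip_star, star_sh, star_mulF, star_star, mulF_sh_r by auto 6 with l2.
  reflexivity.
Qed.

Lemma Cop_Cop (theta f : Z -> C) : unimod theta -> L2 f -> Cop theta (Cop theta f) = f.
Proof.
  intros Ht Hf. rewrite !Cop_eq, star_mulF, star_sh, star_star, <- mulF_sh_r, sh_sh by auto 12 with l2.
  rewrite unimod_inv' by auto 12 with l2. apply sh_0.
Qed.

(** By [ip_Cop], pairing C f with z^n for n < 0 amounts to pairing f with theta z^(-n-1), and
    pairing C f with theta h to pairing f with conj(z h), which has negative frequencies only. *)
Lemma Cop_K (theta f : Z -> C) : unimod theta -> analytic theta -> Kmodel theta f ->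
  Kmodel theta (Cop theta f).
Proof.
  intros Ht Hp Hf. pose proof Hf as [[F1 F2] F3].
  split; [split; [auto 12 with l2 |] |].
  - intros n Hn. rewrite <- ip_e_r, ip_Cop, Cop_eq, ip_conj by auto 12 with l2.
    rewrite F3; [unfold Cconj; simpl; rewrite Ropp_0; reflexivity |].
    split; [auto 12 with l2 |]. intros m Hm. unfold sh, star, e. zcases.
    unfold Cconj; simpl; rewrite Ropp_0; reflexivity.
  - intros h [H1 H2]. rewrite ip_Cop, Cop_eq, star_mulF, <- mulF_sh_r, unimod_inv' by auto 12 with l2.
    rewrite <- sumZ_zero. unfold ip. f_equal. fext. unfold sh, star.
    destruct (Z_lt_le_dec n 0); [rewrite F2 by assumption | rewrite H2 by lia];
    apply injective_projections; simpl; ring.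
Qed.

Lemma Cop_sc (theta f : Z -> C) (c : C) : unimod theta -> L2 f ->
  Cop theta (scF c f) = scF (Cconj c) (Cop theta f).
Proof.
  intros. rewrite !Cop_eq, <- mulF_sc_r by auto 12 with l2. f_equal. fext.
  unfold sh, star, scF. apply Cmult_conj.
Qed.

(** On the circle conj(z k_a) = 1 / (z - a), so C k_a is theta / (z - a). *)
Lemma Cop_ker (theta : Z -> C) (a : C) : unimod theta -> (Cmod a < 1)%R ->
  subF (sh 1 (Cop theta (ker a))) (scF a (Cop theta (ker a))) = theta.
Proof.
  intros Ht Ha. rewrite Cop_eq, mulF_sh_r, sh_sh. rewrite <- mulF_sh_r.
  rewrite <- mulF_sh_r, <- mulF_sc_r, <- mulF_sub_r by auto 12 with l2.
  replace (subF _ _) with (e 0); [rewrite mulF_e by auto 12 with l2; apply sh_0 |].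
  transitivity (star (e 0)).
  - fext. unfold star, e. zcases; unfold Cconj; simpl; rewrite Ropp_0; reflexivity.
  - rewrite <- (ker_inv a). fext. unfold star, subF, scF, sh. rewrite Cminus_conj, Cmult_conj, Cconj_conj.
    do 3 f_equal; try f_equal; lia.
Qed.

Lemma ev_Cop_ker (theta : Z -> C) (a z : C) : unimod theta -> analytic theta -> (Cmod a < 1)%R ->
  (Cmod z < 1)%R -> Kmodel theta (ker a) -> (z - a) * ev (Cop theta (ker a)) z = ev theta z.
Proof.
  intros Ht Hp Ha Hz HK. pose proof (Cop_K theta _ Ht Hp HK) as HC.
  rewrite <- (Cop_ker theta a Ht Ha) at 2.
  rewrite ev_sub, ev_sc, ev_sh1 by eauto 12 with l2.
  rewrite (Kmodel_analytic _ _ HC (-1)%Z) by lia. ring.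
Qed.

Lemma Kmodel_ker (a : nat -> C) (sigma : nat -> bool) (theta : Z -> C) (j : nat) :
  (forall j, (Cmod (a j) < 1)%R) -> blaschke a sigma theta -> sigma j = true ->
  Kmodel theta (ker (a j)).
Proof.
  intros Ha [Ht [Hp [H0 _]]] Hj. split; [split; [auto 12 with l2 | apply analytic_ker] |].
  intros h [H1 H2]. rewrite ip_conj. fold (ev (mulF theta h) (a j)).
  rewrite ev_mulF, H0 by auto 12 with l2. unfold Cconj; apply injective_projections; simpl; ring.
Qed.

(** By the divisibility clause f = theta h with h in H^2, so f is orthogonal to itself. *)
Lemma kernels_total (a : nat -> C) (sigma : nat -> bool) (theta f : Z -> C) :
  blaschke a sigma theta -> Kmodel theta f ->
  (forall j, sigma j = true -> ev f (a j) = 0) -> f = zeroF.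
Proof.
  intros [Ht [Hp [_ Hd]]] [[F1 F2] F3] H. apply norm2_eq0; [exact F1 |].
  assert (E : RtoC (norm2 f) = 0).
  { rewrite <- ip_norm2. rewrite <- (unimod_inv' theta f Ht F1) at 2. apply F3.
    split; [auto 12 with l2 | apply Hd; assumption]. }
  apply RtoC_inj in E. lra.
Qed.

(** [Theta] vanishes at the zeros of [theta], hence every Theta h is theta times a function of
    H^2. *)
Lemma Kmodel_incl (a : nat -> C) (sigma tau : nat -> bool) (theta Theta f : Z -> C) :
  (forall j, (Cmod (a j) < 1)%R) -> (forall j, sigma j = true -> tau j = true) ->
  blaschke a sigma theta -> blaschke a tau Theta -> Kmodel theta f -> Kmodel Theta f.
Proof.
  intros Ha Hst [Ht [Hp [H0 Hd]]] [HT [HP [H1 _]]] [[F1 F2] F3].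
  split; [split; assumption |]. intros h [Hh Hh'].
  rewrite <- (unimod_inv' theta (mulF Theta h)) by auto 12 with l2.
  apply F3. split; [auto 12 with l2 |]. apply Hd; auto 12 with l2.
  - apply analytic_mulF; assumption.
  - intros j Hj. rewrite ev_mulF, H1 by auto 12 with l2. ring.
Qed.

(* A form of [C_theta]-symmetry of the compression that involves neither the projection nor an adjoint. *)
Lemma Csym_iff (theta : Z -> C) (A : (Z -> C) -> Z -> C) : unimod theta -> analytic theta ->
  (forall f, Kmodel theta f -> L2 (A f)) ->
  (compression_Csym theta A <->
   forall f g, Kmodel theta f -> Kmodel theta g -> ip (Cop theta g) (A f) = ip (Cop theta f) (A g)).
Proof.
  intros Ht Hp HA. split.
  - intros H f g Hf Hg. pose proof (Cop_K theta f Ht Hp Hf) as HCf.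
    pose proof (Cop_K theta g Ht Hp Hg) as HCg.
    specialize (H (Cop theta f) g (proj theta (A f)) (proj theta (A g)) HCf Hg).
    rewrite Cop_Cop in H by eauto 12 with l2.
    specialize (H (is_proj_proj _ _ Ht Hp (HA f Hf)) (is_proj_proj _ _ Ht Hp (HA g Hg))).
    rewrite ip_Cop in H by (eauto 12 with l2; eapply Kmodel_L2, proj_in; auto).
    rewrite (ip_conj (proj theta (A f))), (ip_conj (proj theta (A g))) in H.
    rewrite !proj_ip in H by auto. rewrite <- !ip_conj in H. exact H.
  - intros H f g p q Hf Hg Hpp Hpq. pose proof (Cop_K theta f Ht Hp Hf) as HCf.
    pose proof (Cop_K theta g Ht Hp Hg) as HCg.
    pose proof (proj1 Hpp) as Kp. pose proof (proj1 Hpq) as Kq.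
    rewrite ip_Cop by eauto 12 with l2. rewrite (ip_conj p), (ip_conj q).
    rewrite (is_proj_ip _ _ _ _ (HA _ HCf) Hpp HCg), (is_proj_ip _ _ _ _ (HA _ Hg) Hpq Hf).
    rewrite <- !ip_conj, (H _ _ HCf Hg), Cop_Cop by eauto 12 with l2. reflexivity.
Qed.

(** * Truncated Toeplitz operators *)

Lemma Riesz (L : (Z -> C) -> C) (M : R) :
  (forall f g, L2 f -> L2 g -> L (addF f g) = L f + L g) ->
  (forall c f, L2 f -> L (scF c f) = c * L f) ->
  (forall f, L2 f -> (Cmod (L f) ^ 2 <= M * norm2 f)%R) ->
  exists g, L2 g /\ forall f, L2 f -> L f = ip f g.
Proof.
  intros Hadd Hsc Hb. set (g := fun n => Cconj (L (e n))).
  assert (Hcut : forall J f K, (K <= J)%nat -> L (cut K f) = ip (cut K f) (cut J g)).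
  { intros J f K. induction K as [|K IH]; intro HK.
    - rewrite cut_0, ip_zero_l. replace zeroF with (scF 0 (e 0)) by (fext; unfold scF, zeroF; ring).
      rewrite Hsc by auto with l2. ring.
    - assert (Hg : forall n, (- Z.of_nat J <= n < Z.of_nat J)%Z -> L (e n) = Cconj (cut J g n)).
      { intros n Hn. unfold cut, g. zcases. rewrite Cconj_conj. reflexivity. }
      rewrite cut_S, !Hadd, !Hsc, !ip_add_l, !ip_sc_l, !ip_e_l, IH by auto with l2 arith.
      rewrite !Hg by lia. reflexivity. }
  (* On a window of its own representer [L] takes the value s = [norm2 (cut J g)], so the hypothesis
     reads s^2 <= M s. *)
  assert (HM : forall J, (norm2 (cut J g) <= M)%R).
  { intro J. pose proof (Hb (cut J g) (L2_cut J g)) as H.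
    rewrite (Hcut J g J (Nat.le_refl _)), ip_norm2, Cmod_R in H.
    pose proof (norm2_ge0 _ (L2_cut J g)). rewrite Rabs_pos_eq in H by assumption.
    destruct (Req_dec (norm2 (cut J g)) 0) as [E|E]; [| nra].
    (* In the degenerate case the claim is 0 <= M, obtained by testing on one unit vector. *)
    pose proof (Hb (e 0) (L2_e 0)) as He. rewrite norm2_e in He.
    pose proof (Cmod2_ge0 (L (e 0))). lra. }
  destruct (Fatou (fun J => cut J g) g M) as [Hg HgM]; auto with l2.
  { intro n.
    assert (Hev : forall J, (Z.to_nat (Z.abs n) + 1 <= J)%nat -> cut J g n = g n)
      by (intros J HJ; unfold cut; zcases; reflexivity).
    split; (eapply is_lim_seq_ext_loc; [| apply is_lim_seq_const]);
    exists (Z.to_nat (Z.abs n) + 1)%nat; intros J HJ; rewrite Hev by exact HJ; reflexivity. }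
  exists g. split; [exact Hg |]. intros f Hf.
  enough (H : L f - ip f g = 0) by (rewrite <- (Cplus_0_r (ip f g)), <- H; ring).
  apply (L2_dense (fun f => L f - ip f g) (2 * M + 2 * norm2 g)%R); [| | | exact Hf].
  - intros h k Hh Hk. rewrite Hadd, ip_add_l by assumption. ring.
  - intros h Hh. pose proof (Cmod_sub_sq (L h) (ip h g)). pose proof (Hb h Hh).
    pose proof (Cauchy_Schwarz h g Hh Hg). nra.
  - intros c m. rewrite Hsc, ip_sc_l, ip_e_l by auto with l2. unfold g. rewrite Cconj_conj. ring.
Qed.

Lemma bounded_op_add (K : (Z -> C) -> Prop) (A : (Z -> C) -> Z -> C) (f g : Z -> C) :
  bounded_op K A -> K f -> K g -> A (addF f g) = addF (A f) (A g).
Proof.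
  intros [_ [H _]] Hf Hg. specialize (H f g 1 Hf Hg).
  replace (addF f g) with (fun n => 1 * f n + g n) by (fext; unfold addF; ring).
  rewrite H. fext. unfold addF. ring.
Qed.

Lemma bounded_op_sc (theta : Z -> C) (A : (Z -> C) -> Z -> C) (c : C) (f : Z -> C) : unimod theta ->
  bounded_op (Kmodel theta) A -> Kmodel theta f -> A (scF c f) = scF c (A f).
Proof.
  intros Ht HA Hf. pose proof (Kmodel_sc theta f 0 Ht Hf) as H0.
  assert (Z0 : A (scF 0 f) = zeroF).
  { pose proof (bounded_op_add _ A _ _ HA H0 H0) as E.
    replace (addF (scF 0 f) (scF 0 f)) with (scF 0 f) in E by (fext; unfold addF, scF; ring).
    fext. apply (f_equal (fun u => u n - A (scF 0 f) n)) in E. unfold addF in E. unfold zeroF.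
    transitivity (A (scF 0 f) n + A (scF 0 f) n - A (scF 0 f) n); [ring | rewrite <- E; ring]. }
  destruct HA as [_ [H _]]. specialize (H f (scF 0 f) c Hf H0). rewrite Z0 in H.
  replace (scF c f) with (fun n => c * f n + scF 0 f n) by (fext; unfold scF; ring).
  rewrite H. fext. unfold scF, zeroF. ring.
Qed.

Lemma adjoint_exists (theta : Z -> C) (A : (Z -> C) -> Z -> C) (g : Z -> C) :
  unimod theta -> analytic theta -> bounded_op (Kmodel theta) A -> L2 g ->
  exists g', Kmodel theta g' /\ forall f, Kmodel theta f -> ip (A f) g = ip f g'.
Proof.
  intros Ht Hp HA Hg. pose proof HA as [HK [_ [M HM]]].
  assert (HP : forall f, L2 f -> Kmodel theta (proj theta f)) by (intros; apply proj_in; assumption).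
  assert (HAP : forall f, L2 f -> L2 (A (proj theta f))) by (intros; eapply Kmodel_L2, HK, HP; assumption).
  (* [Riesz] wants a functional on all of L^2, so [A] is precomposed with the projection. [Rmax] is
     there because [bounded_op] does not give the sign of [M]. *)
  destruct (Riesz (fun f => ip (A (proj theta f)) g) (Rmax M 0 * norm2 g)) as [g' [H1 H2]].
  - intros f h Hf Hh. rewrite <- ip_add_l by auto with l2.
    rewrite <- (bounded_op_add (Kmodel theta) A) by auto. do 2 f_equal.
    apply proj_eq; auto using Kmodel_add with l2. intros k Hk.
    rewrite !ip_add_l by eauto with l2. rewrite !proj_ip by auto. reflexivity.
  - intros c f Hf. rewrite <- ip_sc_l by auto with l2.
    rewrite <- (bounded_op_sc theta A) by auto. do 2 f_equal.
    apply proj_eq; auto using Kmodel_sc with l2. intros k Hk.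
    rewrite !ip_sc_l by eauto with l2. rewrite !proj_ip by auto. reflexivity.
  - intros f Hf. pose proof (HP f Hf) as Kf.
    eapply Rle_trans; [apply Cauchy_Schwarz; eauto with l2 |].
    pose proof (HM _ Kf). pose proof (norm2_proj theta f Ht Hp Hf).
    pose proof (norm2_ge0 g Hg). pose proof (norm2_ge0 f Hf).
    pose proof (norm2_ge0 _ (Kmodel_L2 _ _ Kf)).
    pose proof (Rmax_l M 0). pose proof (Rmax_r M 0).
    assert (norm2 (A (proj theta f)) <= Rmax M 0 * norm2 f)%R.
    { apply Rle_trans with (Rmax M 0 * norm2 (proj theta f))%R; nra. }
    nra.
  - exists (proj theta g'). split; [auto |]. intros f Hf.
    rewrite (ip_conj (proj theta g')), proj_ip, <- ip_conj by auto.
    rewrite <- H2 by eauto with l2. do 2 f_equal. symmetry. apply proj_eq; eauto with l2.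
Qed.

(** * Operators with a symbol have symmetric compressions *)

Lemma symbol_Csym (theta phi : Z -> C) (a b : C) : unimod theta -> (Cmod a < 1)%R -> (Cmod b < 1)%R ->
  L2 phi ->
  ip (Cop theta (ker b)) (mulF phi (ker a)) = ip (Cop theta (ker a)) (mulF phi (ker b)).
Proof.
  intros Ht Ha Hb Hphi.
  assert (E : forall x c, L2 x -> (Cmod c < 1)%R -> ip x (mulF phi (ker c)) = ip (mulF (star (ker c)) x) phi).
  { intros x c Hx Hc. rewrite mulF_comm, mulF_adj, star_star by auto with l2. reflexivity. }
  rewrite !E by auto with l2. f_equal. rewrite !Cop_eq.
  rewrite (mulF_mulF_comm _ theta), (mulF_mulF_comm _ theta) by auto with l2. 
  rewrite !mulF_sh_r, (mulF_comm (star (ker a))) by auto with l2. reflexivity.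
Qed.

(** For fixed [g] the defect of symmetry is conjugate linear and bounded in [f], hence of the form
    <w, f> with w in the model space; a w that vanishes at the zeros is 0. *)
Lemma Csym_extend (a : nat -> C) (sigma : nat -> bool) (theta Theta : Z -> C)
  (A : (Z -> C) -> Z -> C) (g : Z -> C) :
  (forall j, (Cmod (a j) < 1)%R) -> blaschke a sigma theta ->
  unimod Theta -> analytic Theta -> bounded_op (Kmodel Theta) A ->
  (forall f, Kmodel theta f -> Kmodel Theta f) -> Kmodel theta g ->
  (forall i, sigma i = true -> ip (Cop theta g) (A (ker (a i))) = ip (Cop theta (ker (a i))) (A g)) ->
  forall f, Kmodel theta f -> ip (Cop theta g) (A f) = ip (Cop theta f) (A g).
Proof.
  intros Ha Hb HT HP HA Hincl Hg H. pose proof Hb as [Ht [Hp _]].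
  assert (HAL : forall f, Kmodel theta f -> L2 (A f)).
  { intros f Hf. eapply Kmodel_L2, HA, Hincl, Hf. }
  destruct (adjoint_exists Theta A (Cop theta g) HT HP HA) as [g' [Hg' Hadj]]; [eauto with l2 |].
  pose proof (Kmodel_L2 _ _ Hg') as Lg'.
  pose proof (proj_in theta (A g) Ht Hp (HAL g Hg)) as KAg.
  pose proof (proj_in theta g' Ht Hp Lg') as Kg'.
  pose proof (Cop_K theta _ Ht Hp KAg) as KC.
  set (w := subF (proj theta g') (Cop theta (proj theta (A g)))).
  assert (Kw : Kmodel theta w) by (apply Kmodel_sub; assumption).
  assert (E : forall f, Kmodel theta f -> ip w f = ip (Cop theta g) (A f) - ip (Cop theta f) (A g)).
  { intros f Hf. unfold w. rewrite ip_sub_l, proj_ip by eauto with l2.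
    rewrite ip_Cop, (ip_conj (proj theta (A g))) by eauto with l2.
    rewrite proj_ip, <- ip_conj by (auto; apply Cop_K; assumption).
    rewrite (ip_conj f g'), <- Hadj, <- ip_conj by auto. reflexivity. }
  assert (W : w = zeroF).
  { apply (kernels_total a sigma theta); [assumption .. |]. intros j Hj. unfold ev.
    rewrite E, H by eauto using Kmodel_ker. ring. }
  intros f Hf. specialize (E f Hf). rewrite W, ip_zero_l in E.
  transitivity (ip (Cop theta g) (A f) - 0); [ring | rewrite E; ring].
Qed.

(** The symbol describes [A f] only when phi f is in L^2. Kernels always qualify, and boundedness of
    [A] carries the symmetry to the other vectors. *)
Lemma TTO_Csym (a : nat -> C) (sigma tau : nat -> bool) (theta Theta : Z -> C) (A : (Z -> C) -> Z -> C) :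
  (forall j, (Cmod (a j) < 1)%R) -> (forall j, sigma j = true -> tau j = true) ->
  blaschke a sigma theta -> blaschke a tau Theta -> bounded_op (Kmodel Theta) A ->
  in_TTO Theta A -> compression_Csym theta A.
Proof.
  intros Ha Hst Hb HB HA [phi [Hphi Hin]].
  pose proof Hb as [Ht [Hp _]]. pose proof HB as [HT [HP _]].
  assert (Hincl : forall f, Kmodel theta f -> Kmodel Theta f) by (intro; apply (Kmodel_incl a sigma tau); assumption).
  assert (HAL : forall f, Kmodel theta f -> L2 (A f)).
  { intros f Hf. eapply Kmodel_L2, HA, Hincl, Hf. }
  assert (Hk : forall i k, sigma i = true -> Kmodel theta k -> ip k (A (ker (a i))) = ip k (mulF phi (ker (a i)))).
  { intros i k Hi Hk. assert (L : L2 (mulF phi (ker (a i)))) by (rewrite mulF_comm; auto with l2).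
    rewrite (ip_conj (A _)), (ip_conj (mulF _ _)). f_equal.
    apply (is_proj_ip Theta); [exact L | | apply Hincl, Hk].
    apply Hin; [| exact L]. apply Hincl. eapply Kmodel_ker; eassumption. }
  apply Csym_iff; [assumption .. |].
  (* [Csym_extend] is used once per argument: first with a kernel as the fixed vector, then with an
     arbitrary one. *)
  assert (H1 : forall j, sigma j = true -> forall f, Kmodel theta f ->
    ip (Cop theta (ker (a j))) (A f) = ip (Cop theta f) (A (ker (a j)))).
  { intros j Hj. assert (Kj : Kmodel theta (ker (a j))) by (eapply Kmodel_ker; eassumption).
    apply (Csym_extend a sigma theta Theta); try assumption.
    intros i Hi. assert (Ki : Kmodel theta (ker (a i))) by (eapply Kmodel_ker; eassumption).
    rewrite !Hk by (auto using Cop_K). apply symbol_Csym; auto. }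
  intros f g Hf Hg. apply (Csym_extend a sigma theta Theta); try assumption.
  intros i Hi. symmetry. apply H1; assumption.
Qed.

(* As [phi] and [f] may both be unbounded, [mulF_adj] does not apply; instead, the difference [D f]
   of the two sides satisfies [D f = a * D (conj z * f)] and is bounded along the iteration. *)
Lemma mulF_adj_ker (phi f : Z -> C) (a : C) : (Cmod a < 1)%R -> L2 phi -> L2 f -> L2 (mulF phi f) ->
  ip (mulF phi f) (ker a) = ip f (mulF (star phi) (ker a)).
Proof.
  intros Ha Hphi Hf Hpf.
  assert (Lk : L2 (mulF (star phi) (ker a))) by (rewrite mulF_comm; auto with l2).
  set (D := fun n : nat => ip (sh (- Z.of_nat n) (mulF phi f)) (ker a)
                         - ip (sh (- Z.of_nat n) f) (mulF (star phi) (ker a))).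
  (* Substituting k_a = 1 + conj(a) z k_a in both terms of [D n] produces the same constant, the
     coefficient of phi f at n, and it cancels. *)
  assert (Hstep : forall n, D n = a * D (S n)).
  { intro n. unfold D. replace (- Z.of_nat (S n))%Z with (- (1) + - Z.of_nat n)%Z by lia.
    rewrite <- !sh_sh. set (y := sh (- Z.of_nat n) (mulF phi f)). set (x := sh (- Z.of_nat n) f).
    assert (Ly : L2 y) by (unfold y; auto with l2). assert (Lx : L2 x) by (unfold x; auto with l2).
    rewrite !ip_sh_l by auto with l2. rewrite Z.opp_involutive.
    assert (E1 : ip y (ker a) = y 0%Z + a * ip y (sh 1 (ker a))).
    { rewrite (ker_fix a) at 1. rewrite ip_add_r, ip_sc_r, ip_e_r, Cconj_conj by auto with l2. reflexivity. }
    assert (E2 : ip x (mulF (star phi) (ker a)) = y 0%Z + a * ip x (sh 1 (mulF (star phi) (ker a)))).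
    { rewrite (ker_fix a) at 1. rewrite mulF_add_r, mulF_sc_r, mulF_e, sh_0, mulF_sh_r by auto with l2.
      rewrite ip_add_r, ip_sc_r, Cconj_conj by auto with l2. f_equal.
      unfold y. rewrite <- mulF_sh_r. fold x. rewrite mulF_comm, mulF_ip, sh_0 by auto with l2. reflexivity. }
    rewrite E1, E2. ring. }
  assert (Hpow : forall n, D 0%nat = Cpow a n * D n).
  { induction n as [|n IH]; [simpl; ring |]. rewrite IH, Hstep. simpl. ring. }
  set (c := (2 * (norm2 (mulF phi f) * norm2 (ker a)) + 2 * (norm2 f * norm2 (mulF (star phi) (ker a))))%R).
  assert (Hb : forall n, (Cmod (D n) ^ 2 <= c)%R).
  { intro n. eapply Rle_trans; [apply Cmod_sub_sq |]. unfold c.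
    rewrite <- (norm2_sh (- Z.of_nat n) (mulF phi f)), <- (norm2_sh (- Z.of_nat n) f) by assumption.
    apply Rplus_le_compat; (apply Rmult_le_compat_l; [lra |]); apply Cauchy_Schwarz; auto with l2. }
  assert (H0 : D 0%nat = 0).
  { apply Cmod2_eq0.
    apply (is_lim_seq_le (fun _ => Cmod (D 0%nat) ^ 2)%R (fun n => c * (Cmod a ^ 2) ^ n)%R (Cmod (D 0%nat) ^ 2)%R 0%R).
    - intro n. rewrite (Hpow n), Cmod_mult, Cmod_pow, Rpow_mult_distr, <- !pow_mult, Nat.mul_comm, Rmult_comm.
      apply Rmult_le_compat_r; [| apply Hb]. rewrite pow_mult. apply pow_le, Cmod2_ge0.
    - apply is_lim_seq_const.
    - pose proof (is_lim_seq_scal_l _ c _ (is_lim_seq_geom (Cmod a ^ 2)%R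
        ltac:(rewrite Rabs_pos_eq by apply Cmod2_ge0; apply Cmod_pow2_lt1, Ha))) as K.
      simpl in K. rewrite Rmult_0_r in K. exact K. }
  unfold D in H0. simpl in H0. rewrite !sh_0 in H0.
  transitivity (ip (mulF phi f) (ker a) - 0); [ring | rewrite <- H0; ring].
Qed.

(* Splitting [1 / ((1 - conj b z) (1 - a conj z))] into an analytic and a co-analytic part. *)
Lemma ip_symbol (phi : Z -> C) (a b : C) : (Cmod a < 1)%R -> (Cmod b < 1)%R -> L2 phi ->
  (1 - a * Cconj b) * ip (mulF phi (ker b)) (ker a) =
  ip phi (ker a) + ip phi (star (ker b)) - phi 0%Z.
Proof.
  intros Ha Hb Hphi.
  assert (Ly : L2 (mulF phi (ker b))) by (rewrite mulF_comm; auto with l2).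
  assert (Ey : mulF phi (ker b) = addF phi (scF (Cconj b) (sh 1 (mulF phi (ker b))))).
  { rewrite (ker_fix b) at 1. rewrite mulF_add_r, mulF_sc_r, mulF_e, sh_0, mulF_sh_r by auto with l2.
    reflexivity. }
  assert (E0 : ip phi (star (ker b)) = mulF phi (ker b) 0%Z) by (rewrite mulF_ip, sh_0; reflexivity).
  set (y := mulF phi (ker b)) in *.
  assert (E1 : y 0%Z = phi 0%Z + Cconj b * y (-1)%Z) by exact (f_equal (fun u => u 0%Z) Ey).
  assert (E2 : ip y (ker a) = ip phi (ker a) + Cconj b * (y (-1)%Z + a * ip y (ker a))).
  { transitivity (ip (addF phi (scF (Cconj b) (sh 1 y))) (ker a)); [f_equal; exact Ey |].
    rewrite ip_add_l, ip_sc_l by auto with l2.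
    fold (ev (sh 1 y) a). rewrite ev_sh1 by auto with l2. reflexivity. }
  rewrite E0, E1.
  transitivity (ip y (ker a) - a * Cconj b * ip y (ker a)); [ring |].
  rewrite E2 at 1. ring.
Qed.

Lemma ip_star_ker (f : Z -> C) (a : C) : analytic f -> ip f (star (ker a)) = f 0%Z.
Proof.
  intro Hp. rewrite <- (ip_e_r f 0). apply ip_analytic_ext; [exact Hp |].
  intros n Hn. unfold star, ker, e. zcases.
  - subst n. simpl. unfold Cconj; simpl. rewrite Ropp_0. reflexivity.
  - unfold Cconj; simpl. rewrite Ropp_0. reflexivity.
Qed.

(* [A - A_phi] annihilates the kernel at [a] on both sides, for the symbol
   [(1 - conj a z) A k_a + conj ((1 - conj a z) A^* k_a) - c]. *)
Lemma symbol_exists (theta : Z -> C) (A : (Z -> C) -> Z -> C) (a : C) :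
  unimod theta -> analytic theta -> bounded_op (Kmodel theta) A -> (Cmod a < 1)%R ->
  Kmodel theta (ker a) ->
  exists phi, L2 phi /\ forall b, (Cmod b < 1)%R -> Kmodel theta (ker b) ->
    ip (mulF phi (ker a)) (ker b) = ip (A (ker a)) (ker b) /\
    ip (mulF phi (ker b)) (ker a) = ip (A (ker b)) (ker a).
Proof.
  intros Ht Hp HA Ha Ka. destruct (adjoint_exists theta A (ker a) Ht Hp HA) as [g [Kg Hg]]; [auto with l2 |].
  assert (KA : Kmodel theta (A (ker a))) by (apply HA, Ka).
  (* Multiplication by 1 - conj(a) z, which matches the factor in front of [ip_symbol] when one of
     the two points is a. *)
  set (T := fun f => subF f (scF (Cconj a) (sh 1 f))).
  assert (HT : forall f, Kmodel theta f -> L2 (T f) /\ analytic (T f) /\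
    forall b, (Cmod b < 1)%R -> ev (T f) b = (1 - Cconj a * b) * ev f b).
  { intros f Hf. pose proof (Kmodel_L2 _ _ Hf) as Lf. pose proof (Kmodel_analytic _ _ Hf) as Pf.
    split; [unfold T; auto with l2 |]. split.
    - intros n Hn. unfold T, subF, scF, sh. rewrite !Pf by lia. ring.
    - intros b Hb. unfold T. rewrite ev_sub, ev_sc, ev_sh1, Pf by (auto with l2; lia). ring. }
  destruct (HT _ KA) as [X1 [X2 X3]]. destruct (HT _ Kg) as [Y1 [Y2 Y3]].
  set (chi := T (A (ker a))) in *. set (psi := T g) in *. set (m := (1 - a * Cconj a) * ip (A (ker a)) (ker a)).
  set (phi := subF (addF chi (star psi)) (scF m (e 0))).
  assert (Lphi : L2 phi) by (unfold phi; auto with l2).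
  (* For d = a the middle term on the right equals [m], for b = a the first one does; what remains
     is the prescribed row or column. *)
  assert (E : forall b d, (Cmod b < 1)%R -> (Cmod d < 1)%R -> Kmodel theta (ker d) ->
    (1 - b * Cconj d) * ip (mulF phi (ker d)) (ker b) =
    (1 - Cconj a * b) * ip (A (ker a)) (ker b) + (1 - a * Cconj d) * ip (A (ker d)) (ker a) - m).
  { intros b d Hb Hd Kd. rewrite ip_symbol by assumption.
    assert (P1 : ip phi (ker b) = ev chi b + Cconj (psi 0%Z) - m).
    { unfold phi. rewrite ip_sub_l, ip_add_l, ip_sc_l by auto with l2.
      fold (ev chi b) (ev (e 0) b). rewrite ev_e0.
      rewrite <- (star_star (ker b)), ip_star, ip_conj, ip_star_ker by auto with l2. ring. }
    assert (P2 : ip phi (star (ker d)) = chi 0%Z + Cconj (ev psi d) - m).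
    { unfold phi. rewrite ip_sub_l, ip_add_l, ip_sc_l, ip_star, !ip_star_ker by auto using analytic_e0 with l2.
      rewrite (ip_conj psi). unfold ev, e. zcases. ring. }
    assert (P3 : phi 0%Z = chi 0%Z + Cconj (psi 0%Z) - m).
    { unfold phi, subF, addF, scF, star, e. zcases. simpl. ring. }
    rewrite P1, P2, P3, X3, Y3 by assumption. unfold ev.
    rewrite (Hg _ Kd), (ip_conj g (ker d)), !Cmult_conj, Cminus_conj, Cmult_conj, Cconj_conj.
    replace (Cconj 1) with (RtoC 1) by (apply injective_projections; simpl; ring). ring. }
  exists phi. split; [exact Lphi |]. intros b Hb Kb.
  assert (N1 : 1 - b * Cconj a <> 0) by (rewrite Cmult_comm; apply one_minus_neq0; assumption).
  assert (N2 : 1 - a * Cconj b <> 0) by (rewrite Cmult_comm; apply one_minus_neq0; assumption).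
  pose proof (E b a Hb Ha Ka) as E1. pose proof (E a b Ha Hb Kb) as E2. fold m in E1. unfold m in E2.
  split.
  - apply (f_equal (fun x => x / (1 - b * Cconj a))) in E1.
    transitivity ((1 - b * Cconj a) * ip (mulF phi (ker a)) (ker b) / (1 - b * Cconj a)); [field; exact N1 |].
    rewrite E1. field. exact N1.
  - apply (f_equal (fun x => x / (1 - a * Cconj b))) in E2.
    transitivity ((1 - a * Cconj b) * ip (mulF phi (ker b)) (ker a) / (1 - a * Cconj b)); [field; exact N2 |].
    rewrite E2. field. exact N2.
Qed.

(** C k_n vanishes at the earlier zeros, because (a_l - a_n) times its value there is theta(a_l). It
    does not vanish at a_n, since otherwise it would be 0 and so would k_n = C C k_n. Subtracting a
    multiple of it from [z] kills the last value too. *)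
Lemma blaschke_last (a : nat -> C) (n : nat) (theta z : Z -> C) :
  (forall j, (Cmod (a j) < 1)%R) -> (forall i j, a i = a j -> i = j) ->
  blaschke a (fun j => Nat.ltb j (S n)) theta -> Kmodel theta z ->
  (forall l, (l < n)%nat -> ev z (a l) = 0) ->
  exists c, z = scF c (Cop theta (ker (a n))).
Proof.
  intros Ha Hinj Hb Hz H0. pose proof Hb as [Ht [Hp [Hzero _]]].
  assert (Kn : Kmodel theta (ker (a n))) by (eapply Kmodel_ker; [exact Ha | exact Hb | apply Nat.ltb_lt; lia]).
  pose proof (Cop_K theta _ Ht Hp Kn) as KC.
  set (w := Cop theta (ker (a n))) in *.
  assert (Hw : forall l, (l < n)%nat -> ev w (a l) = 0).
  { intros l Hl. assert (E : (a l - a n) * ev w (a l) = 0).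
    { unfold w. rewrite ev_Cop_ker by auto. apply Hzero, Nat.ltb_lt. lia. }
    destruct (Ceq_dec (ev w (a l)) 0) as [K|K]; [exact K |]. exfalso. revert E. apply Cmult_neq_0; [| exact K].
    intro Q. assert (a l = a n) by (rewrite <- (Cplus_0_l (a n)), <- Q; ring).
    apply Hinj in H. lia. }
  assert (Hn : ev w (a n) <> 0).
  { intro K. assert (W : w = zeroF).
    { apply (kernels_total a _ theta w Hb KC). intros j Hj. apply Nat.ltb_lt in Hj.
      destruct (Nat.eq_dec j n) as [->|]; [exact K | apply Hw; lia]. }
    assert (E : ev (Cop theta w) (a n) = 0).
    { rewrite W. unfold ev. rewrite ip_Cop, ip_zero_r by auto with l2. reflexivity. }
    unfold w in E. rewrite Cop_Cop, ev_ker in E by auto with l2.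
    pose proof (one_minus_neq0 _ _ (Ha n) (Ha n)) as Q.
    apply (f_equal (fun x => x * (1 - Cconj (a n) * a n))) in E.
    replace (1 / (1 - Cconj (a n) * a n) * (1 - Cconj (a n) * a n)) with (RtoC 1) in E by (field; exact Q).
    rewrite Cmult_0_l in E. apply RtoC_inj in E. lra. }
  exists (ev z (a n) / ev w (a n)). set (c := ev z (a n) / ev w (a n)).
  assert (E : subF z (scF c w) = zeroF).
  { apply (kernels_total a _ theta _ Hb).
    - apply Kmodel_sub; [assumption .. | apply Kmodel_sc; assumption].
    - intros j Hj. apply Nat.ltb_lt in Hj. rewrite ev_sub, ev_sc by eauto with l2.
      destruct (Nat.eq_dec j n) as [->|].
      + unfold c. field. exact Hn.
      + rewrite H0, Hw by lia. ring. }
  fext. apply (f_equal (fun u => u n0 + scF c w n0)) in E. unfold subF, zeroF in E.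
  transitivity (z n0 - scF c w n0 + scF c w n0); [ring | rewrite E; ring].
Qed.

(** [E] stands for A minus multiplication by phi. It is controlled on kernels only and takes values
    outside the model space, so the hypotheses mention kernels alone and the argument works with the
    projections [y]. *)
Lemma Csym_step (a : nat -> C) (n : nat) (theta : Z -> C) (E : (Z -> C) -> Z -> C) :
  (forall j, (Cmod (a j) < 1)%R) -> (forall i j, a i = a j -> i = j) ->
  blaschke a (fun j => Nat.ltb j (S n)) theta ->
  (forall j, L2 (E (ker (a j)))) ->
  (forall i j, (i < S n)%nat -> (j < S n)%nat ->
     ip (Cop theta (ker (a j))) (E (ker (a i))) = ip (Cop theta (ker (a i))) (E (ker (a j)))) ->
  (forall i, ip (E (ker (a 0%nat))) (ker (a i)) = 0) ->
  (forall i, ip (E (ker (a i))) (ker (a 0%nat)) = 0) ->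
  (forall i j, (i < n)%nat -> (j < n)%nat -> ip (E (ker (a j))) (ker (a i)) = 0) ->
  forall i j, (i < S n)%nat -> (j < S n)%nat -> ip (E (ker (a j))) (ker (a i)) = 0.
Proof.
  intros Ha Hinj Hb HL Hsym Hrow Hcol Hind. pose proof Hb as [Ht [Hp _]].
  assert (Hk : forall j, (j < S n)%nat -> Kmodel theta (ker (a j))).
  { intros j Hj. eapply Kmodel_ker; [exact Ha | exact Hb | apply Nat.ltb_lt; exact Hj]. }
  set (y := fun j => proj theta (E (ker (a j)))).
  assert (Ky : forall j, Kmodel theta (y j)) by (intro j; apply proj_in; auto).
  assert (Hy : forall i j, (i < S n)%nat -> ev (y j) (a i) = ip (E (ker (a j))) (ker (a i))).
  { intros i j Hi. unfold ev, y. apply proj_ip; auto. }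
  (* The symmetry of [E] becomes a symmetric matrix of values of the functions C y_i at the
     zeros. *)
  assert (Hys : forall i j, (i < S n)%nat -> (j < S n)%nat ->
     ev (Cop theta (y i)) (a j) = ev (Cop theta (y j)) (a i)).
  { assert (Q : forall i j, (i < S n)%nat -> (j < S n)%nat ->
      ev (Cop theta (y i)) (a j) = ip (Cop theta (ker (a j))) (E (ker (a i)))).
    { intros i j Hi Hj. unfold ev. rewrite ip_Cop, ip_conj by eauto with l2. unfold y.
      rewrite proj_ip, <- ip_conj by auto using Cop_K. reflexivity. }
    intros i j Hi Hj. rewrite !Q by assumption. apply Hsym; assumption. }
  assert (Hnz : forall b c, (Cmod b < 1)%R -> (Cmod c < 1)%R -> ev (ker b) c <> 0).
  { intros b c Hb' Hc K. rewrite ev_ker in K by assumption.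
    pose proof (one_minus_neq0 b c Hb' Hc) as Q. apply (f_equal (fun x => x * (1 - Cconj b * c))) in K.
    replace (1 / (1 - Cconj b * c) * (1 - Cconj b * c)) with (RtoC 1) in K by (field; exact Q).
    rewrite Cmult_0_l in K. apply RtoC_inj in K. lra. }
  assert (Hsc0 : forall f, scF 0 f = zeroF) by (intro f; fext; unfold scF, zeroF; ring).
  assert (HC0 : Cop theta zeroF = zeroF).
  { rewrite <- (Hsc0 zeroF), Cop_sc by auto with l2. fext. unfold scF, Cconj; simpl.
    apply injective_projections; simpl; ring. }
  assert (Hlow : forall i, (i < n)%nat -> y i = zeroF).
  { assert (Hlam : forall i, (i < n)%nat -> exists c, y i = scF c (Cop theta (ker (a n)))).
    { intros i Hi. apply (blaschke_last a n theta); auto. intros l Hl. rewrite Hy by lia. apply Hind; assumption. }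
    intros i Hi. destruct (Hlam i Hi) as [c Hc].
    assert (Y0 : y 0%nat = zeroF).
    { apply (kernels_total a _ theta _ Hb (Ky 0%nat)). intros j Hj. apply Nat.ltb_lt in Hj.
      rewrite Hy by exact Hj. apply Hrow. }
    assert (S0 : Cconj c * ev (ker (a n)) (a 0%nat) = 0).
    { rewrite <- ev_sc by auto with l2.
      (* [Cop] is conjugate linear and involutive, so it turns c C k_n into conj(c) k_n. *)
      replace (scF (Cconj c) (ker (a n))) with (Cop theta (y i)).
      - rewrite Hys, Y0, HC0 by lia. apply ip_zero_l.
      - rewrite Hc, Cop_sc, Cop_Cop by auto with l2. reflexivity. }
    destruct (Ceq_dec (Cconj c) 0) as [K|K].
    - rewrite Hc. replace c with (RtoC 0); [apply Hsc0 |].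
      rewrite <- (Cconj_conj c), K. apply injective_projections; simpl; ring.
    - exfalso. revert S0. apply Cmult_neq_0; auto. }
  assert (Hlast : y n = zeroF).
  { destruct (blaschke_last a n theta (Cop theta (y n)) Ha Hinj Hb) as [c Hc].
    - apply Cop_K; auto.
    - intros l Hl. rewrite Hys, Hlow, HC0 by lia. apply ip_zero_l.
    - assert (Yn : y n = scF (Cconj c) (ker (a n))).
      { rewrite <- (Cop_Cop theta (y n)) by eauto with l2.
        rewrite Hc, Cop_sc, Cop_Cop by auto with l2. reflexivity. }
      assert (S0 : Cconj c * ev (ker (a n)) (a 0%nat) = 0).
      { rewrite <- ev_sc, <- Yn, Hy by (auto with l2; lia). apply Hcol. }
      destruct (Ceq_dec (Cconj c) 0) as [K|K].
      + rewrite Yn, K. apply Hsc0.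
      + exfalso. revert S0. apply Cmult_neq_0; auto. }
  intros i j Hi Hj. rewrite <- Hy by exact Hi.
  destruct (Nat.eq_dec j n) as [->|]; [rewrite Hlast | rewrite Hlow by lia]; apply ip_zero_l.
Qed.

Lemma TTO_of_kernels (a : nat -> C) (theta phi : Z -> C) (A : (Z -> C) -> Z -> C) :
  (forall j, (Cmod (a j) < 1)%R) -> blaschke a (fun _ => true) theta ->
  bounded_op (Kmodel theta) A -> L2 phi ->
  (forall i j, ip (A (ker (a j))) (ker (a i)) = ip (mulF phi (ker (a j))) (ker (a i))) ->
  in_TTO theta A.
Proof.
  intros Ha Hb HA Hphi H. pose proof Hb as [Ht [Hp _]].
  assert (Hk : forall j, Kmodel theta (ker (a j))) by (intro j; eapply Kmodel_ker; eauto).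
  assert (Hclaim : forall i f, Kmodel theta f -> L2 (mulF phi f) ->
     ip (mulF phi f) (ker (a i)) = ip (A f) (ker (a i))).
  { intro i. destruct (adjoint_exists theta A (ker (a i)) Ht Hp HA) as [g [Kg Hg]]; [auto with l2 |].
    assert (Lp : L2 (mulF (star phi) (ker (a i)))) by (rewrite mulF_comm; auto with l2).
    (* The two functionals of f to be compared differ by the pairing of f with [d], so it suffices
       that the projection of [d] vanishes at every zero. *)
    set (d := subF (mulF (star phi) (ker (a i))) g).
    assert (Ld : L2 d) by (unfold d; eauto with l2).
    assert (E : proj theta d = zeroF).
    { apply (kernels_total a (fun _ => true) theta); [exact Hb | apply proj_in; assumption |].
      intros j _. unfold ev. rewrite proj_ip by auto. unfold d. rewrite ip_conj, ip_sub_r by eauto with l2.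
      rewrite <- Hg, H, mulF_adj_ker by (auto with l2; rewrite mulF_comm; auto with l2).
      unfold Cconj; apply injective_projections; simpl; ring. }
    intros f Hf Hpf. rewrite Hg, mulF_adj_ker by eauto with l2.
    pose proof (proj_ip theta d f Ht Hp Ld Hf) as Q. rewrite E, ip_zero_l in Q.
    unfold d in Q. rewrite ip_conj, ip_sub_r in Q by eauto with l2.
    apply (f_equal Cconj) in Q. rewrite Cconj_conj in Q.
    transitivity (ip f (mulF (star phi) (ker (a i))) - ip f g + ip f g); [ring |].
    rewrite <- Q. unfold Cconj; apply injective_projections; simpl; ring. }
  exists phi. split; [exact Hphi |]. intros f Hf Hpf.
  replace (A f) with (proj theta (mulF phi f)); [apply is_proj_proj; assumption |].
  pose proof (proj_in theta _ Ht Hp Hpf) as Kp. pose proof (proj1 HA f Hf) as KA.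
  assert (E : subF (proj theta (mulF phi f)) (A f) = zeroF).
  { apply (kernels_total a (fun _ => true) theta); [exact Hb | apply Kmodel_sub; assumption |].
    intros j _. rewrite ev_sub by eauto with l2. unfold ev. rewrite proj_ip, Hclaim by auto. ring. }
  fext. apply (f_equal (fun u => u n + A f n)) in E. unfold subF, zeroF in E.
  transitivity (proj theta (mulF phi f) n - A f n + A f n); [ring | rewrite E; ring].
Qed.

(** The hypothesis fixes only the zeros of each [theta], so it is met by the products of (2) and by
    those of (3), whose unimodular constants differ. *)
Lemma Csym_TTO (a : nat -> C) (Theta : Z -> C) (A : (Z -> C) -> Z -> C) :
  (forall j, (Cmod (a j) < 1)%R) -> (forall i j, a i = a j -> i = j) ->
  blaschke a (fun _ => true) Theta -> bounded_op (Kmodel Theta) A ->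
  (forall n, exists theta, blaschke a (fun j => Nat.ltb j (S n)) theta /\ compression_Csym theta A) ->
  in_TTO Theta A.
Proof.
  intros Ha Hinj HB HA H. pose proof HB as [HT [HP _]].
  assert (Hk : forall j, Kmodel Theta (ker (a j))) by (intro j; eapply Kmodel_ker; eauto).
  destruct (symbol_exists Theta A (a 0%nat) HT HP HA (Ha 0%nat) (Hk 0%nat)) as [phi [Hphi Hs]].
  assert (Lp : forall j, L2 (mulF phi (ker (a j)))) by (intro; rewrite mulF_comm; auto with l2).
  assert (LA : forall j, L2 (A (ker (a j)))) by (intro j; eapply Kmodel_L2, HA, Hk).
  set (E := fun f => subF (A f) (mulF phi f)).
  assert (LE : forall j, L2 (E (ker (a j)))) by (intro; unfold E; auto with l2).
  assert (HE : forall n i j, (i < n)%nat -> (j < n)%nat -> ip (E (ker (a j))) (ker (a i)) = 0).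
  { induction n as [|n IH]; [intros; lia |].
    destruct (H n) as [theta [Hb Hsym]]. pose proof Hb as [Ht [Hp _]].
    assert (Hkt : forall j, (j < S n)%nat -> Kmodel theta (ker (a j))).
    { intros j Hj. eapply Kmodel_ker; [exact Ha | exact Hb | apply Nat.ltb_lt; exact Hj]. }
    assert (HAL : forall f, Kmodel theta f -> L2 (A f)).
    { intros f Hf. eapply Kmodel_L2, HA.
      exact (Kmodel_incl a (fun j => Nat.ltb j (S n)) (fun _ => true) theta Theta f Ha (fun _ _ => eq_refl) Hb HB Hf). }
    assert (Hsym' := proj1 (Csym_iff theta A Ht Hp HAL) Hsym).
    apply (Csym_step a n theta E); auto.
    - intros i j Hi Hj. unfold E. rewrite !ip_sub_r by auto with l2.
      rewrite (Hsym' (ker (a i)) (ker (a j))) by auto. rewrite (symbol_Csym theta phi (a i) (a j)) by auto.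
      reflexivity.
    - intro i. unfold E. rewrite ip_sub_l by auto with l2. rewrite (proj1 (Hs (a i) (Ha i) (Hk i))). ring.
    - intro i. unfold E. rewrite ip_sub_l by auto with l2. rewrite (proj2 (Hs (a i) (Ha i) (Hk i))). ring. }
  apply (TTO_of_kernels a Theta phi); [assumption .. |].
  (* Any stage beyond both indices will do. *)
  intros i j. specialize (HE (S (i + j)) i j ltac:(lia) ltac:(lia)).
  unfold E in HE. rewrite ip_sub_l in HE by auto with l2.
  transitivity (ip (A (ker (a j))) (ker (a i)) - ip (mulF phi (ker (a j))) (ker (a i)) + ip (mulF phi (ker (a j))) (ker (a i)));
    [ring | rewrite HE; ring].
Qed.

(** * Assembling the two equivalences *)

Lemma bprod_taylor_exists (a : nat -> C) (sigma : nat -> bool) (g : R) :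
  (forall j, (Cmod (a j) < 1)%R) -> (forall i j, a i = a j -> i = j) ->
  ex_series (fun j => (1 - Cmod (a j))%R) ->
  exists c, taylor_of (bprod a sigma g) c.
Proof.
  intros Ha Hinj Hs.
  destruct (bprod_limit a sigma g Ha Hinj Hs) as [theta [Hb Hv]].
  exists (fun k => theta (Z.of_nat k)). apply taylor_intro; [apply Hb | apply Hb | exact Hv].
Qed.

Theorem theorem5p1 (a : nat -> C) (gamma : R) (cB : nat -> C)
  (A : (Z -> C) -> Z -> C) :
  (forall j, (Cmod (a j) < 1)%R) ->
  ex_series (fun j => (1 - Cmod (a j))%R) ->
  (exists delta : R, (0 < delta)%R /\
     forall n, Rbar_le (Finite delta) (Lim_seq (sep_partial a n))) ->
  taylor_of (bprod a (fun _ => true) gamma) cB ->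
  bounded_op (Kmodel (extZ cB)) A ->
  (in_TTO (extZ cB) A <->
     (forall (sigma : nat -> bool) (gamma' : R) (csigma : nat -> C),
        (exists j, sigma j = true) ->
        taylor_of (bprod a sigma gamma') csigma ->
        compression_Csym (extZ csigma) A))
  /\
  (in_TTO (extZ cB) A <->
     (forall (n : nat) (cn : nat -> C), (1 <= n)%nat ->
        taylor_of (fun _ => Bn a n) cn ->
        compression_Csym (extZ cn) A)).
Proof.
  intros Ha Hs [delta [Hd Hsep]] HtB HA.
  pose proof (separated_inj a delta Hd Hsep) as Hinj.
  pose proof (bprod_blaschke a _ gamma cB Ha Hinj Hs HtB) as HB.
  split; split.
  - intros HTTO sigma g c _ Hc.
    apply (TTO_Csym a sigma (fun _ => true) _ (extZ cB)); auto.
    apply (bprod_blaschke a sigma g); assumption.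
  - intro H. apply (Csym_TTO a); auto. intro n.
    (* Among all subproducts, those with an initial segment of zeros suffice. *)
    destruct (bprod_taylor_exists a (fun j => Nat.ltb j (S n)) 0 Ha Hinj Hs) as [c Hc].
    exists (extZ c). split; [apply (bprod_blaschke a _ 0); assumption |].
    apply (H (fun j => Nat.ltb j (S n)) 0%R c); [exists 0%nat; reflexivity | exact Hc].
  - intros HTTO n c _ Hc.
    pose proof (Bn_blaschke a n Ha Hinj) as Hb.
    (* The sequence [c] is arbitrary with the right Taylor sums; uniqueness identifies it with the
       explicit product. *)
    rewrite (taylor_extZ _ c (Bcoef a n) Hc) by (try apply Hb; intros; apply cvC_Bn; assumption).
    apply (TTO_Csym a (fun j => Nat.ltb j n) (fun _ => true) _ (extZ cB)); auto.
  (* Condition (3) counts factors from 1 and [Csym_TTO] stages from 0, hence [S n]. *)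
  - intro H. apply (Csym_TTO a); auto. intro n. exists (Bcoef a (S n)).
    pose proof (Bn_blaschke a (S n) Ha Hinj) as Hb. split; [exact Hb |].
    destruct (taylor_intro (fun _ => Bn a (S n)) (Bcoef a (S n))) as [T1 T2];
      [apply Hb | apply Hb | intros; apply cvC_Bn; assumption |].
    rewrite <- T2. apply (H (S n)); [lia | exact T1].
Qed.
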